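(* For every admissible index $\boldsymbol{k}=(k_1,\ldots,k_r)$ with dual index $\boldsymbol{k}^\dagger$ and for $s\in\mathbb{C}$, we have \[ I_{\boldsymbol{k}}(s)=I_{\boldsymbol{k}^\dagger}(s), \] where $I_{\boldsymbol{k}}$ and $I_{\boldsymbol{k}^\dagger}$ denote the meromorphic functions on $\mathbb{C}$ obtained by meromorphic continuation of their defining series (so this is an identity of meromorphic functions on $\mathbb{C}$).
   Context: An index $\boldsymbol{k}=(k_1,\ldots,k_r)\in\mathbb{Z}_{\ge1}^r$ ($r\ge1$) is called admissible if $k_r\ge2$. Dual index: every admissible index can be written uniquely in the form \[ \boldsymbol{k}=(\underbrace{1,\ldots,1}_{a_1-1},b_1+1,\dots,\underbrace{1,\ldots,1}_{a_l-1},b_l+1) \] with $l\ge1$ and integers $a_p,b_q\ge1$. Its dual index is \[ \boldsymbol{k}^\dagger:=(\underbrace{1,\ldots,1}_{b_l-1},a_l+1,\dots,\underbrace{1,\ldots,1}_{b_1-1},a_1+1), \] which is again admissible. For an admissible index $\boldsymbol{k}=(k_1,\ldots,k_r)$ and $s\in\mathbb{C}$, define \[ I_{\boldsymbol{k}}(s):=\sum_{i=1}^{r}\ \sum_{0<n_1<\cdots<n_r}\frac{1}{n_1^{k_1}\cdots n_r^{k_r}}\cdot\frac{1}{n_i^{s}}\prod_{j\ne i}\frac{n_j}{n_j-n_i}, \] where $n_1,\ldots,n_r$ run over integers and the product is over $j\in\{1,\ldots,r\}\setminus\{i\}$ (the empty product is $1$). This series converges absolutely for $\Re(s)>-1$,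 and $I_{\boldsymbol{k}}(s)$ is continued meromorphically to all of $\mathbb{C}$ (it is a finite signed sum of special cases of the zeta function associated with the root system of type $A_r$, i.e. the Witten multiple zeta function associated with $\mathfrak{sl}(r+1)$, which is known to have a meromorphic continuation to $\mathbb{C}^{r(r+1)/2}$). The continued function is again denoted $I_{\boldsymbol{k}}(s)$. *)

(* Defs.v *)
From HB Require Import structures.
From mathcomp Require Import all_boot all_order all_algebra.
From mathcomp Require Import all_classical all_reals all_analysis.
From mathcomp Require Import finmap complex.

Set Implicit Arguments.
Unset Strict Implicit.
Unset Printing Implicit Defensive.

Import Order.TTheory GRing.Theory Num.Theory.
Import numFieldNormedType.Exports.

Local Open Scope classical_set_scope.
Local Open Scope ring_scope.

Definition is_index (k : seq nat) : bool :=
  (0 < size k)%N && all (leq 1) k.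

Definition admissible (k : seq nat) : bool :=
  is_index k && (1 < last 0 k)%N.

(* [:: (a_1, b_1); ...; (a_l, b_l)] represents the index
   (1^(a_1 - 1), b_1 + 1, ..., 1^(a_l - 1), b_l + 1). *)
Definition index_of_blocks (ab : seq (nat * nat)) : seq nat :=
  flatten [seq rcons (nseq p.1.-1 1%N) p.2.+1 | p <- ab].

(* The accumulator a is one more than the number of 1's read since the last
   entry >= 2. *)
Fixpoint blocks_rec (a : nat) (k : seq nat) : seq (nat * nat) :=
  match k with
  | [::] => [::]
  | b.+2 :: k' => (a, b.+1) :: blocks_rec 1 k'
  | _ :: k' => blocks_rec a.+1 k'
  end.

Definition blocks (k : seq nat) : seq (nat * nat) := blocks_rec 1 k.

Definition dual_index (k : seq nat) : seq nat :=
  index_of_blocks (rev [seq (p.2, p.1) | p <- blocks k]).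

Definition pos_blocks (ab : seq (nat * nat)) : bool :=
  (0 < size ab)%N && all (fun p => (0 < p.1)%N && (0 < p.2)%N) ab.

Lemma index_of_blocksK (ab : seq (nat * nat)) :
  pos_blocks ab -> blocks (index_of_blocks ab) = ab.
Proof.
case/andP => _; rewrite /blocks; elim: ab => //= -[a b] ab IH /=.
move=> /andP[/andP[a0 b0] /IH {}IH].
have blocks_ones m n s : blocks_rec m (nseq n 1%N ++ s) = blocks_rec (n + m) s.
  by elim: n m => //= n IHn m; rewrite IHn addnS.
rewrite /index_of_blocks /= -cats1 -catA blocks_ones /= addn1 prednK //.
by case: b b0 => //= b _; rewrite -/(index_of_blocks ab) IH.
Qed.

Lemma blocksK (k : seq nat) : admissible k ->
  pos_blocks (blocks k) /\ index_of_blocks (blocks k) = k.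
Proof.
case/andP => /andP[k0 kpos] klast.
suff H m : (0 < m)%N -> pos_blocks (blocks_rec m k) /\
    index_of_blocks (blocks_rec m k) = nseq m.-1 1%N ++ k by exact: H.
elim: k k0 kpos klast m => // x k IH _ /= /andP[x0 kpos] klast m m0.
case: x x0 klast => // -[|b] _ klast.
  case: k => [|y k] in IH kpos klast * => //.
  have [H1 H2] := IH isT kpos klast m.+1 isT.
  split; first by [].
  by rewrite H2; case: m m0 {H1 H2} => // m _; rewrite -cat_rcons; elim: m => //= m [->].
case: k => [|y k] in IH kpos klast *.
  by rewrite /pos_blocks /index_of_blocks /= m0 cats0 cats1.
have [H1 H2] := IH isT kpos klast 1%N isT.
split; first by move: H1; rewrite /pos_blocks /= m0 => /andP[_ ->].
by rewrite /index_of_blocks /= -/(index_of_blocks _) H2 /= cat_rcons.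
Qed.

Lemma admissible_index_of_blocks (ab : seq (nat * nat)) :
  pos_blocks ab -> admissible (index_of_blocks ab).
Proof.
case/lastP: ab => // ab [a b] /andP[_]; rewrite all_rcons /= => /andP[/andP[_ b0] _].
rewrite /admissible /is_index /index_of_blocks map_rcons -cats1 flatten_cat /= cats0.
rewrite !last_cat last_rcons ltnS b0 andbT size_cat size_rcons addnS /=.
rewrite all_cat all_rcons /= all_nseq orbT !andbT.
by elim: ab => //= p ab IH; rewrite all_cat all_rcons all_nseq orbT.
Qed.

Lemma admissible_dual_index (k : seq nat) : admissible k -> admissible (dual_index k).
Proof.
move=> /blocksK[/andP[s0 bpos] _]; apply: admissible_index_of_blocks.
rewrite /pos_blocks size_rev size_map s0 all_rev all_map /=.
by apply: sub_all bpos => p /=; rewrite andbC.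
Qed.

Section Interpolation.
Variable R : realType.
Local Notation C := R[i]^o.

Definition cexp (z : C) : C :=
  (expR (complex.Re z))%:C%C * (cos (complex.Im z) +i* sin (complex.Im z))%C.

(* n ^ s for a positive integer n *)
Definition cpow (n : nat) (s : C) : C := cexp (s * (ln n%:R)%:C%C).

(* Unconditional convergence (convergence along the finite subsets of D),
   which for complex families is the same as absolute convergence. *)
Definition has_sum (T : choiceType) (D : set T) (f : T -> C) (l : C) : Prop :=
  forall e : R, 0 < e -> exists2 A : {fset T}, [set` A] `<=` D &
    forall B : {fset T}, [set` A] `<=` [set` B] -> [set` B] `<=` D ->
      `|\sum_(x <- B) f x - l| < e%:C%C.

Definition csum (T : choiceType) (D : set T) (f : T -> C) : C :=
  xget 0 [set l | has_sum D f l].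

Definition I_term (k : seq nat) (s : C) (i : 'I_(size k))
    (n : (size k).-tuple nat) : C :=
  let x j : C := (tnth n j)%:R in
  (\prod_(j < size k) x j ^+ nth 0%N k j)^-1 * (cpow (tnth n i) s)^-1 *
  \prod_(j < size k | j != i) (x j / (x j - x i)).

(* path ltn 0 n says 0 < n_1 < ... < n_r *)
Definition I_series (k : seq nat) (s : C) : C :=
  \sum_(i < size k)
    csum [set n : (size k).-tuple nat | path ltn 0%N n] (I_term s i).

Definition analytic_at (f : C -> C) (z0 : C) : Prop :=
  exists a : nat -> C, \forall z \near z0,
    series (fun n => a n * (z - z0) ^+ n) @ \oo --> f z.

(* The value of f at a pole is irrelevant. *)
Definition pole_at (f : C -> C) (z0 : C) : Prop :=
  exists m (a : nat -> C), [/\ (0 < m)%N, a 0%N != 0 &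
    \forall z \near z0^',
      series (fun n => a n * (z - z0) ^+ n) @ \oo --> (z - z0) ^+ m * f z].

Definition meromorphic (f : C -> C) : Prop :=
  forall z0, analytic_at f z0 \/ pole_at f z0.

Definition I_continuation (k : seq nat) (F : C -> C) : Prop :=
  meromorphic F /\ forall s : C, -1 < complex.Re s -> F s = I_series k s.

(* Equality as meromorphic functions: the same poles, and the same values
   elsewhere. *)
Definition meromorphic_eq (F G : C -> C) : Prop :=
  forall s, (pole_at F s <-> pole_at G s) /\ (~ pole_at F s -> F s = G s).

End Interpolation.

(* Main.v *)
(* Interchanging the sums, I_k(s) = L_k(n^-s) for the linear functional
   L_k(phi) = sum_i sum_n c_i(n) phi(n_i), with
   c_i(n) = prod_j n_j^-k_j prod_(j != i) n_j / (n_j - n_i); it is bounded for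
   the sup norm because sum_i sum_n |c_i(n)| < oo.  Partial fractions turn
   L_k(n / (n - x)) into the generating function of Ohno's relation,
   sum_n prod_j n_j^-(k_j - 1) / (n_j - x), which for 0 <= x < 1 is a series of positive terms
   and is invariant under duality by the connected sum method of Seki and Yamamoto.  Hence
   Lambda = L_k - L_(k^dagger) kills n / (n - x) for small x > 0.  Expanding at x = 0, Lambda kills
   every n^-m; letting m grow, (j / n)^m isolates the smallest index, so Lambda kills the indicator
   of each j >= 1; and for Re s > 0 the sequence n^-s is a uniform limit of combinations of
   indicators.  So the two series agree on Re s > 0, and the identity theorem, applied along a
   segment from 1, propagates the equality to the whole plane. *)

Require Import Defs.
From mathcomp Require Import all_boot all_order all_algebra.
From mathcomp Require Import all_classical all_reals all_analysis.
From mathcomp Require Import complex.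
From mathcomp Require Import finmap ring lra zify.

Set Implicit Arguments.
Unset Strict Implicit.
Unset Printing Implicit Defensive.
Import Order.TTheory GRing.Theory Num.Theory.
Import numFieldNormedType.Exports.
Local Open Scope classical_set_scope.
Local Open Scope ring_scope.

(** * The identity theorem for meromorphic functions *)

Lemma geometric_sum_half (K : numFieldType) (t : K) n :
  0 <= t -> t <= 2^-1 -> \sum_(i < n) t ^+ i <= 2.
Proof.
move=> t0 t2; suff: \sum_(i < n) t ^+ i + 2 * t ^+ n <= 2.
  by apply: le_trans; rewrite lerDl mulr_ge0 ?exprn_ge0.
elim: n => [|n IH]; first by rewrite big_ord0 add0r expr0 mulr1.
apply: le_trans IH; rewrite big_ord_recr /= -addrA lerD2l exprS.
have -> : 2 * t ^+ n = t ^+ n + t ^+ n by rewrite mulrDl mul1r.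
rewrite lerD2l mulrA -[leRHS]mul1r ler_wpM2r ?exprn_ge0 //.
by rewrite -(@ler_pM2l _ 2^-1) ?invr_gt0 // mulr1 mulKf // pnatr_eq0.
Qed.

Lemma near_dnbhs_norm (K : numFieldType) (z0 : K^o) (d : K) : 0 < d ->
  \forall z \near z0^', `|z - z0| < d.
Proof.
move=> d0; rewrite near_withinE; near=> z => _; rewrite distrC.
by near: z; apply: filterS (nbhsx_ballx z0 _ d0) => z; rewrite -ball_normE.
Unshelve. all: by end_near. Qed.

(** The second hypothesis says that zeros of [h] accumulate at [z0]. At a zero close to [z0] the
    first possibly nonzero term must be cancelled by the tail, which is smaller by a factor of order
    |z - z0|; letting z tend to [z0] forces its coefficient to vanish. *)
Lemma pseries_coef_eq0 (K : numFieldType) (c : nat -> K^o) (h : K^o -> K^o)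
    (z0 : K^o) :
  (\forall z \near z0^', series (fun n => c n * (z - z0) ^+ n) @ \oo --> h z) ->
  (forall P : set K^o, (\forall z \near z0^', P z) -> exists2 z, P z & h z = 0) ->
  forall n, c n = 0.
Proof.
move=> hc h0.
have [w0 [w0N0 cvgw0]] : exists w0, w0 != 0 /\
    cvgn (series (fun n => c n * w0 ^+ n : K^o)).
  move: hc; rewrite near_withinE => /nbhs_ballP[e /= e0 He].
  have e20 : 0 < e / 2 by rewrite divr_gt0.
  have zz : z0 + e / 2 - z0 = e / 2 by rewrite addrC addKr.
  exists (e / 2); split; first by rewrite gt_eqF.
  have := He (z0 + e / 2); rewrite zz => H; apply/cvg_ex; eexists; apply: H.
    rewrite -ball_normE /= opprD addrA subrr add0r normrN gtr0_norm //.
    by rewrite ltr_pdivrMr // ltr_pMr // ltr1n.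
  by rewrite -subr_eq0 zz gt_eqF.
(* Convergence at the single point [w0] bounds all its terms, which controls every coefficient at
   once. *)
have [B B0 HB] : exists2 B, 0 < B & forall j, `|c j| * `|w0| ^+ j <= B.
  have /cvg_series_cvg_0/cvgP/cvg_seq_bounded/pinfty_ex_gt0[B B0 HB] := cvgw0.
  by exists B => // j; move: (HB j I) => /=; rewrite normrM normrX.
have w00 : 0 < `|w0| by rewrite normr_gt0.
elim/ltn_ind => n IH.
(* Chosen so that the bound 2 B t^(n+1) obtained below, with t = |w| / |w0|, equals [L] |w|^(n+1);
   hence |c_n| <= [L] |w|, which is below [e] once |w| < [e / L]. *)
pose L := 2 * B / `|w0| ^+ n.+1.
have L0 : 0 < L by rewrite divr_gt0 ?mulr_gt0 ?exprn_gt0.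
suff H e : 0 < e -> `|c n| <= e.
  apply/eqP; rewrite -normr_le0; apply/ler_addgt0Pr => e e0.
  by rewrite add0r; exact: H.
move=> e0.
have [z [Hz [zN [z1 z2]]] hz] : exists2 z,
    (series (fun n => c n * (z - z0) ^+ n) @ \oo --> h z) /\ z != z0 /\
    `|z - z0| < `|w0| / 2 /\ `|z - z0| < e / L & h z = 0.
  apply: h0; near=> z; split; first by near: z.
  split; first by near: z; exact: nbhs_dnbhs_neq.
  by split; near: z; apply: near_dnbhs_norm; rewrite divr_gt0.
rewrite {}hz in Hz; set w := z - z0 in Hz z1 z2.
have w_gt0 : 0 < `|w| by rewrite normr_gt0 subr_eq0.
pose t := `|w| / `|w0|.
have t0 : 0 <= t by rewrite divr_ge0.
have t12 : t <= 2^-1 by rewrite ler_pdivrMr // mulrC ltW.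
have wt : `|w| = t * `|w0| by rewrite divfK ?gt_eqF.
suff H : `|c n| * `|w| ^+ n <= 2 * B * t ^+ n.+1.
  rewrite -(ler_pM2r (exprn_gt0 n w_gt0)); apply: le_trans H _.
  rewrite expr_div_n mulrA mulrAC -/L exprS mulrA.
  by rewrite ler_wpM2r ?exprn_ge0 // mulrC -ler_pdivlMr // ltW.
apply/ler_addgt0Pr => d d0.
have [N HN nN] : exists2 N, `|series (fun n => c n * w ^+ n) N| < d & (n < N)%N.
  have /cvgrPdist_lt/(_ d d0)[N _ HN] := Hz.
  exists (maxn N n.+1); last by rewrite leq_maxr.
  have := HN (maxn N n.+1) (leq_maxl _ _).
  by rewrite sub0r normrN.
(* Terms before [n] vanish by induction; those after [n] are dominated by a geometric series of
   ratio t <= 1/2, whose sum is at most 2. *)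
have : `|c n * w ^+ n| <= `|series (fun n => c n * w ^+ n) N| + 2 * B * t ^+ n.+1.
  rewrite /series /= (big_cat_nat (n := n.+1)) //= big_nat_recr //=.
  rewrite big_nat big1 => [|i /andP[_ /IH ->]]; last by rewrite mul0r.
  rewrite add0r; set S := \sum_(_ <= _ < _) _.
  rewrite -{1}[c n * _](addrK S) (le_trans (ler_normB _ _)) // lerD2l.
  rewrite /S -{1}[n.+1]add0n big_addn big_mkord (le_trans (ler_norm_sum _ _ _)) //.
  apply: (@le_trans _ _ (\sum_(i < N - n.+1) B * t ^+ n.+1 * t ^+ i)).
    apply: ler_sum => i _; rewrite normrM normrX wt exprMn mulrCA mulrC.
    by rewrite -mulrA -exprD addnC ler_wpM2r // exprn_ge0.
  rewrite -mulr_sumr -[2 * B * _]mulrA [2 * _]mulrC ler_wpM2l //.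
    by rewrite mulr_ge0 ?exprn_ge0 // ltW.
  exact: geometric_sum_half.
rewrite normrM normrX => /le_trans; apply.
by rewrite addrC lerD2l ltW.
Unshelve. all: by end_near. Qed.

(** A point other than [z0] has a neighbourhood avoiding [z0]. This makes the set of points around
    which two functions agree open. *)
Lemma near_near_dnbhs (K : numFieldType) (z0 : K^o) (P : set K^o) :
  (\forall z \near z0^', P z) -> \forall y \near z0, \forall z \near y^', P z.
Proof.
rewrite near_withinE => Pz0; have := near_join Pz0; apply: filterS => y Hy.
have [->|yz] := eqVneq y z0; first by rewrite near_withinE.
have yz0 : 0 < `|y - z0| by rewrite normr_gt0 subr_eq0.
have Py := near_dnbhs_norm y yz0.
near=> z; have [zz0|zz0] := eqVneq z z0.
  have : `|z - y| < `|y - z0| by near: z.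
  by rewrite zz0 distrC ltxx.
by move: zz0; near: z; exact: nbhs_dnbhs.
Unshelve. all: by end_near. Qed.

(** Brings Laurent expansions with different exponents [m] to a common one, so that they can be
    subtracted. *)
Lemma pseries_shift (K : numFieldType) (a : nat -> K^o) (w l : K^o) m :
  series (fun n => a n * w ^+ n) @ \oo --> l ->
  series (fun n => (if (n < m)%N then 0 else a (n - m)%N) * w ^+ n) @ \oo -->
    w ^+ m * l.
Proof.
move=> al; rewrite -(cvg_shiftn m).
rewrite [X in X @ _](_ : _ = fun n => w ^+ m * series (fun n => a n * w ^+ n) n).
  by apply: cvgMr.
apply/funext => n; rewrite /series /= (big_cat_nat (n := m)) ?leq_addl //=.
rewrite big_nat big1 => [|i /andP[_ ->]]; last by rewrite mul0r.
rewrite add0r -{1}[m]add0n big_addn addnK big_distrr; apply: eq_bigr => i _ /=.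
by rewrite ltnNge leq_addl addnK /= mulrCA -exprD addnC.
Qed.

Lemma pseriesB (K : numFieldType) (a b : nat -> K^o) (w : K^o) :
  series (fun n => (a n - b n) * w ^+ n) =
  (fun N => series (fun n => a n * w ^+ n) N - series (fun n => b n * w ^+ n) N).
Proof.
apply/funext => n; rewrite /series /= -sumrB; apply: eq_bigr => i _.
by rewrite mulrBl.
Qed.

Section LaurentExpansion.
Variable K : numFieldType.
Implicit Types f g : K^o -> K^o.

(** Covers [analytic_at] and [pole_at] together: [m] may be 0 and the leading coefficient may
    vanish. *)
Definition laurent_at f (z0 : K^o) : Prop :=
  exists m (a : nat -> K^o), \forall z \near z0^',
    series (fun n => a n * (z - z0) ^+ n) @ \oo --> (z - z0) ^+ m * f z.

(** Multiplied by (z - z0)^(m + m'), the difference of [f] and [g] is a power series whose zeros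
    accumulate at [z0], so all its coefficients are 0. *)
Lemma laurent_eq_near f g (z0 : K^o) : laurent_at f z0 -> laurent_at g z0 ->
  (forall P : set K^o, (\forall z \near z0^', P z) -> exists2 z, P z & f z = g z) ->
  \forall z \near z0^', f z = g z.
Proof.
move=> [m [a fa]] [m' [b gb]] fg.
pose c n : K^o := (if (n < m')%N then 0 else a (n - m')%N) -
            (if (n < m)%N then 0 else b (n - m)%N).
pose h (z : K^o) : K^o := (z - z0) ^+ (m + m') * (f z - g z).
have hc : \forall z \near z0^', series (fun n => c n * (z - z0) ^+ n) @ \oo --> h z.
  near=> z.
  have fz : series (fun n => a n * (z - z0) ^+ n) @ \oo --> (z - z0) ^+ m * f z.
    by near: z.
  have gz : series (fun n => b n * (z - z0) ^+ n) @ \oo --> (z - z0) ^+ m' * g z.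
    by near: z.
  have -> : h z = (z - z0) ^+ m' * ((z - z0) ^+ m * f z) -
      (z - z0) ^+ m * ((z - z0) ^+ m' * g z).
    by rewrite /h !mulrA -!exprD addnC -mulrBr.
  rewrite pseriesB.
  exact: cvgB (pseries_shift (m := m') fz) (pseries_shift (m := m) gz).
have c0 : forall n, c n = 0.
  apply: (pseries_coef_eq0 hc) => P /fg[y Py fgy]; exists y => //.
  by rewrite /h fgy subrr mulr0.
near=> z.
have zz0 : z != z0 by near: z; exact: nbhs_dnbhs_neq.
have : series (fun n => c n * (z - z0) ^+ n) @ \oo --> h z by near: z.
rewrite [X in X @ _](_ : _ = fun=> 0); last first.
  by apply/funext => n; rewrite /series /= big1 // => i _; rewrite c0 mul0r.
move=> hz; have /eqP : h z = 0 by exact: norm_cvg_unique hz (cvg_cst _).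
rewrite /h mulf_eq0 expf_eq0 subr_eq0.
by rewrite (negPf zz0) andbF subr_eq0 => /eqP.
Unshelve. all: by end_near. Qed.

(** Agreement around [z0] kills the coefficients of the difference series; since this series also
    converges to f - g at the centre itself, the values there agree too. *)
Lemma pseries_eq_at f g (z0 : K^o) (a b : nat -> K^o) :
  (\forall z \near z0, series (fun n => a n * (z - z0) ^+ n) @ \oo --> f z) ->
  (\forall z \near z0, series (fun n => b n * (z - z0) ^+ n) @ \oo --> g z) ->
  (\forall z \near z0^', f z = g z) -> f z0 = g z0.
Proof.
move=> fa gb fg; pose c n : K^o := a n - b n; pose h (z : K^o) : K^o := f z - g z.
have hc : \forall z \near z0, series (fun n => c n * (z - z0) ^+ n) @ \oo --> h z.
  near=> z.
  have fz : series (fun n => a n * (z - z0) ^+ n) @ \oo --> f z by near: z.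
  have gz : series (fun n => b n * (z - z0) ^+ n) @ \oo --> g z by near: z.
  by rewrite pseriesB; exact: cvgB fz gz.
have c0 : forall n, c n = 0.
  apply: (pseries_coef_eq0 (nbhs_dnbhs hc)) => P Pz0.
  have : \forall z \near z0^', P z /\ f z = g z by near=> z; split; near: z.
  by move=> /(@filter_ex _ _ _)[z [Pz fgz]]; exists z; rewrite // /h fgz subrr.
have := nbhs_singleton hc.
rewrite [X in X @ _](_ : _ = fun=> 0); last first.
  by apply/funext => n; rewrite /series /= big1 // => i _; rewrite c0 mul0r.
move=> hz; have /eqP : h z0 = 0 by exact: norm_cvg_unique hz (cvg_cst _).
by rewrite subr_eq0 => /eqP.
Unshelve. all: by end_near. Qed.

End LaurentExpansion.

Section Meromorphic.
Variable R : realType.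
Local Notation C := R[i]^o.

Lemma meromorphic_laurent (f : C -> C) z0 : meromorphic f -> laurent_at f z0.
Proof.
move=> /(_ z0)[[a fa]|[m [a [_ _ fa]]]]; last by exists m, a.
exists 0%N, a; apply: nbhs_dnbhs; apply: filterS fa => z.
by rewrite expr0 mul1r.
Qed.

Lemma segment_continuous (u v : C) :
  continuous (fun t : R => u + t%:C%C * v : C).
Proof.
move=> t; apply: cvgD; first exact: cvg_cst.
apply: cvgMl; apply/cvgrPdist_lt => e e0.
have e0' : 0 < complex.Re e by case: e e0 => a b; rewrite ltcE /= => /andP[].
have -> : e = (complex.Re e)%:C%C by case: e e0 {e0'} => a b; rewrite ltcE /= => /andP[/eqP -> _].
near=> y.
rewrite -rmorphB /= normc_def /= expr0n addr0 sqrtr_sqr ltcR.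
by near: y; exact: cvgr_dist_lt.
Unshelve. all: by end_near. Qed.

Lemma Re_gt0_near1 (z : C) : `|z - 1| < 1 -> 0 < complex.Re z.
Proof.
case: z => a b; rewrite normc_def /= ltcE /= => /andP[_ ab1].
have : `|a - 1| < 1.
  by rewrite -sqrtr_sqr; apply: le_lt_trans ab1; apply: ler_wsqrtr; rewrite lerDl sqr_ge0.
by rewrite ltr_norml => /andP[+ _]; lra.
Qed.

Lemma meromorphic_identity (F G : C -> C) : meromorphic F -> meromorphic G ->
  (forall z, 0 < complex.Re z -> F z = G z) ->
  forall z0, \forall z \near z0^', F z = G z.
Proof.
move=> mF mG FG z0.
pose E := [set z : C | \forall y \near z^', F y = G y].
have oE : open E by move=> z; exact: near_near_dnbhs.
(* Every punctured neighbourhood of a limit point of [E] contains points where [F] and [G] agree,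
   which is all that the local Laurent comparison asks for. *)
have cE : closed E.
  move=> z zE; apply: laurent_eq_near; [exact: meromorphic_laurent..|].
  move=> P /near_near_dnbhs /zE [y [Ey Py]].
  have : \forall x \near y^', P x /\ F x = G x by near=> x; split; near: x.
  by move=> /(@filter_ex _ _ _)[x [Px FGx]]; exists x.
(* Parametrizing the line through 1 and [z0] reduces the argument to connectedness of the real line.
   The parameter 0 lies in the preimage of [E], because the unit disc around 1 is inside Re z >
   0. *)
pose g (t : R) : C := 1 + t%:C%C * (z0 - 1).
have [ogE cgE] : clopen (g @^-1` E).
  by apply: preimage_clopen => //; exact: segment_continuous.
have : connected [set: R] by apply/connected_intervalP => x y.
move=> /(_ (g @^-1` E)) H.
suff : (g @^-1` E) 1 by rewrite /g /= mul1r addrC subrK.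
rewrite H //.
- exists 0; rewrite /g /= mul0r addr0 /E /=.
  by near=> z; apply/FG/Re_gt0_near1; near: z; exact: near_dnbhs_norm.
- by exists (g @^-1` E) => //; rewrite setTI.
- by exists (g @^-1` E) => //; rewrite setTI.
Unshelve. all: by end_near. Qed.

(** Being a pole depends only on values in a punctured neighbourhood, so the poles coincide;
    elsewhere both functions are analytic and the values at the centre follow from
    [pseries_eq_at]. *)
Lemma meromorphic_eq_near (F G : C -> C) : meromorphic F -> meromorphic G ->
  (forall z0, \forall z \near z0^', F z = G z) -> meromorphic_eq F G.
Proof.
move=> mF mG FG s.
have poleE (f g : C -> C) : (\forall z \near s^', f z = g z) -> pole_at f s -> pole_at g s.
  move=> fg [m [a [m0 a0 fa]]]; exists m, a; split; [exact: m0|exact: a0|].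
  by apply: filterS2 fg fa => z ->.
have FGs := FG s.
have GFs : \forall z \near s^', G z = F z by apply: filterS FGs => z ->.
split; first by split; exact: poleE.
move=> nF; have nG : ~ pole_at G s by move=> pG; apply: nF; exact: poleE pG.
have [[a Fa]|pF] := mF s; last by have := nF pF.
have [[b Gb]|pG] := mG s; last by have := nG pG.
exact: pseries_eq_at Fa Gb FGs.
Qed.

End Meromorphic.

(** * Unconditional sums *)

Section HasSum.
Variable R : realType.
Local Notation C := R[i]^o.
Variables (T : choiceType) (D : set T).
Implicit Types (f g : T -> C) (l : C) (A B : {fset T}).

Lemma fsetU_sub A B : [set` A] `<=` D -> [set` B] `<=` D -> [set` (A `|` B)%fset] `<=` D.
Proof. by move=> AD BD x /=; rewrite in_fsetU => /orP[/AD|/BD]. Qed.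

Lemma has_sum_unique f l l' : has_sum D f l -> has_sum D f l' -> l = l'.
Proof.
move=> fl fl'; apply/eqP; rewrite -subr_eq0 -normr_le0; apply/ler_addgt0Pr => e e0.
rewrite add0r.
have [r r0 er] : exists2 r : R, 0 < r & e = (r + r)%:C%C.
  case: e e0 => a b; rewrite ltcE /= => /andP[/eqP -> a0].
  by exists (a / 2); [rewrite divr_gt0|rewrite -splitr].
have [A AD HA] := fl r r0; have [B BD HB] := fl' r r0.
have := HA (A `|` B)%fset; have := HB (A `|` B)%fset.
set S := \sum_(_ <- _) _; move=> H1 H2.
have -> : l - l' = (S - l') - (S - l) by ring.
apply: le_trans (ler_normB _ _) _; rewrite er rmorphD /= lerD // ltW //.
- by apply: H1; [move=> x /= xB; rewrite in_fsetU xB orbT|exact: fsetU_sub].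
- by apply: H2; [move=> x /= xB; rewrite in_fsetU xB|exact: fsetU_sub].
Qed.

Lemma csumE f l : has_sum D f l -> csum D f = l.
Proof.
move=> fl; rewrite /csum; case: xgetP => [l' _|/(_ l)//].
by move=> /has_sum_unique; apply.
Qed.

Lemma eq_has_sum f g l : (forall x, D x -> f x = g x) -> has_sum D f l -> has_sum D g l.
Proof.
move=> fg fl e e0; have [A AD HA] := fl e e0; exists A => // B AB BD.
rewrite -(eq_big_seq (F1 := f)) => [|x xB]; [exact: HA|exact/fg/BD].
Qed.

Lemma has_sumD f g l l' : has_sum D f l -> has_sum D g l' ->
  has_sum D (fun x => f x + g x) (l + l').
Proof.
move=> fl gl e e0; have e20 : 0 < e / 2 by rewrite divr_gt0.
have [A AD HA] := fl _ e20; have [B BD HB] := gl _ e20.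
exists (A `|` B)%fset; first exact: fsetU_sub.
move=> E ABE ED; rewrite big_split /= opprD addrACA [e]splitr rmorphD /=.
apply: le_lt_trans (ler_normD _ _) _; apply: ltrD.
- by apply: HA => // x xA; apply: ABE; rewrite /= in_fsetU xA.
- by apply: HB => // x xA; apply: ABE; rewrite /= in_fsetU xA orbT.
Qed.

Lemma has_sumZ (c : C) f l : has_sum D f l -> has_sum D (fun x => c * f x) (c * l).
Proof.
move=> fl e e0.
have c0 : 0 < 1 + complex.Re `|c| by rewrite normc_def /= ltr_pwDl // sqrtr_ge0.
have [A AD HA] := fl (e / (1 + complex.Re `|c|)) (divr_gt0 e0 c0).
exists A => // B AB BD; rewrite -mulr_sumr -mulrBr normrM.
have -> : e%:C%C = (1 + `|c|) * (e / (1 + complex.Re `|c|))%:C%C.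
  have cE : `|c| = (complex.Re `|c|)%:C%C by rewrite normc_def.
  rewrite {1}cE -(rmorph1 (real_complex R)) -rmorphD -rmorphM /=.
  by rewrite mulrC divfK // gt_eqF.
have := HA B AB BD; set d := `|_| => dlt.
apply: le_lt_trans (_ : (1 + `|c|) * d < _).
  by rewrite ler_wpM2r ?normr_ge0 // lerDr.
by rewrite ltr_pM2l // ltr_pwDl.
Qed.

Lemma has_sum_sum (I : Type) (s : seq I) (F : I -> T -> C) (L : I -> C) :
  (forall i, has_sum D (F i) (L i)) ->
  has_sum D (fun x => \sum_(i <- s) F i x) (\sum_(i <- s) L i).
Proof.
move=> FL; elim: s => [|i s IH].
  move=> e e0; exists fset0 => // B _ _; rewrite big_nil big1 ?subrr ?normr0 ?ltcR //.
  by move=> x _; rewrite big_nil.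
rewrite big_cons; apply: eq_has_sum (has_sumD (FL i) IH) => x _.
by rewrite big_cons.
Qed.

Lemma has_sum_norm_le f l (M : C) : has_sum D f l ->
  (forall B, [set` B] `<=` D -> `|\sum_(x <- B) f x| <= M) -> `|l| <= M.
Proof.
move=> fl fM; apply/ler_addgt0Pr => e e0.
have [r r0 ->] : exists2 r : R, 0 < r & e = r%:C%C.
  by case: e e0 => a b; rewrite ltcE /= => /andP[/eqP -> a0]; exists a.
have [A AD HA] := fl r r0.
rewrite -[l](subKr (\sum_(x <- A) f x)).
apply: le_trans (ler_normB _ _) _; apply: lerD; first exact: fM.
by apply/ltW/HA.
Qed.

Lemma has_sum_ge0 (f : T -> R) (M : R) : (forall x, D x -> 0 <= f x) ->
  (forall B, [set` B] `<=` D -> \sum_(x <- B) f x <= M) ->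
  exists l : R, has_sum D (fun x => (f x)%:C%C) l%:C%C.
Proof.
move=> f0 fM.
pose S := [set r | exists2 B : {fset T}, [set` B] `<=` D & r = \sum_(x <- B) f x].
have supS : has_sup S.
  split; last by exists M => r [B BD ->]; exact: fM.
  by exists 0; exists fset0 => //; rewrite big_seq_fset0.
exists (sup S) => e e0.
have [r [A AD ->] HA] := sup_adherent e0 supS.
exists A => // B AB BD.
rewrite -rmorph_sum /= -rmorphB /= normc_def /= expr0n addr0 sqrtr_sqr ltcR.
have leS : \sum_(x <- B) f x <= sup S by apply: ub_le_sup; [exact: supS.2|exists B].
rewrite distrC ger0_norm ?subr_ge0 //.
suff : \sum_(x <- A) f x <= \sum_(x <- B) f x by lra.
have -> : \sum_(x <- A) f x = \sum_(x <- B | x \in A) f x.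
  rewrite -[RHS]big_filter; apply: perm_big; apply: uniq_perm => //; rewrite ?filter_uniq //.
  move=> x; rewrite mem_filter; apply/idP/andP => [xA|[]//]; split=> //; exact: AB.
rewrite [leRHS](bigID (mem A)) /= lerDl big_seq_cond sumr_ge0 // => x /andP[xB _].
exact/f0/BD.
Qed.

(** Write f = (g + f) - g, a difference of two nonnegative families with bounded finite sums. *)
Lemma has_sum_real (f g : T -> R) (M : R) : (forall x, D x -> `|f x| <= g x) ->
  (forall B, [set` B] `<=` D -> \sum_(x <- B) g x <= M) ->
  exists l : R, has_sum D (fun x => (f x)%:C%C) l%:C%C.
Proof.
move=> fg gM.
have [l1 H1] : exists l : R, has_sum D (fun x => (g x)%:C%C) l%:C%C.
  by apply: has_sum_ge0 gM => x Dx; apply: le_trans (fg x Dx).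
have [l2 H2] : exists l : R, has_sum D (fun x => (g x + f x)%:C%C) l%:C%C.
  apply: (@has_sum_ge0 _ (M + M)) => [x Dx|B BD].
    by have := fg x Dx; rewrite ler_norml => /andP[+ _]; lra.
  rewrite big_split /= lerD ?gM // (le_trans _ (gM _ BD)) // big_seq [leRHS]big_seq.
  by apply: ler_sum => x /BD/fg; rewrite ler_norml => /andP[].
exists (l2 - l1).
have := has_sumD H2 (has_sumZ (-1) H1); rewrite mulN1r -rmorphB.
by apply: eq_has_sum => x _; rewrite mulN1r -rmorphB /= addrAC subrr add0r.
Qed.

Lemma has_sum_summable f (g : T -> R) (M : R) :
  (forall x, D x -> `|f x| <= (g x)%:C%C) ->
  (forall B, [set` B] `<=` D -> \sum_(x <- B) g x <= M) ->
  exists l, has_sum D f l.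
Proof.
move=> fg gM.
have [l1 H1] : exists l : R, has_sum D (fun x => (complex.Re (f x))%:C%C) l%:C%C.
  apply: has_sum_real gM => x /fg; rewrite normc_def lecR; apply: le_trans.
  by rewrite -sqrtr_sqr ler_wsqrtr // lerDl sqr_ge0.
have [l2 H2] : exists l : R, has_sum D (fun x => (complex.Im (f x))%:C%C) l%:C%C.
  apply: has_sum_real gM => x /fg; rewrite normc_def lecR; apply: le_trans.
  by rewrite -sqrtr_sqr ler_wsqrtr // lerDr sqr_ge0.
eexists; apply: eq_has_sum (has_sumD H1 (has_sumZ 'i%C H2)) => x _.
by rewrite -complexE.
Qed.

Lemma has_sum_Re (f : T -> R) l : has_sum D (fun x => (f x)%:C%C) l ->
  l = (complex.Re l)%:C%C.
Proof.
case: l => a b fl /=; suff -> : b = 0 by [].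
apply/eqP; rewrite -normr_le0; apply/ler_addgt0Pr => e e0; rewrite add0r.
have [A AD HA] := fl e e0; have := HA A (fun=> id) AD.
rewrite -rmorph_sum normc_def ltcR /= => /ltW; apply: le_trans.
by rewrite -[leLHS]sqrtr_sqr ler_wsqrtr // sub0r sqrrN lerDr sqr_ge0.
Qed.

(** Lets an unconditional sum be computed along any exhaustion by finite sets, here later by
    truncating the largest summation variable. *)
Lemma has_sum_cvg (f : T -> R) (l : R) (B : nat -> {fset T}) :
  has_sum D (fun x => (f x)%:C%C) l%:C%C ->
  (forall n, [set` B n] `<=` D) ->
  (forall x, D x -> exists n0, forall n, (n0 <= n)%N -> x \in B n) ->
  (\sum_(x <- B n) f x) @[n --> \oo] --> l.
Proof.
move=> fl BD exB; apply/cvgrPdist_lt => e e0.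
have [A AD HA] := fl e e0.
suff [n0 Hn0] : exists n0, forall n, (n0 <= n)%N -> [set` A] `<=` [set` B n].
  exists n0 => // n /Hn0 AB.
  have := HA (B n) AB (BD n); rewrite -rmorph_sum -rmorphB /= normc_def /=.
  by rewrite expr0n addr0 sqrtr_sqr ltcR distrC.
have /choice[N HN] : forall x, exists N, x \in A -> forall n, (N <= n)%N -> x \in B n.
  move=> x; have [xA|xA] := boolP (x \in A); last by exists 0%N.
  by have [N HN] := exB x (AD x xA); exists N.
exists (\max_(x <- A) N x) => n nA x /= xA; apply: HN => //.
by apply: leq_trans nA; exact: leq_bigmax_seq.
Qed.

End HasSum.

(** * Connected sums *)

Section ConnectedSum.
Variables (R : realType) (x : R).
Hypotheses (x0 : 0 <= x) (x1 : x < 1).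

(** The shifted factorial Gamma(n + 1 - x) / Gamma(1 - x), equal to n! at x = 0. *)
Definition rfact (n : nat) : R := \prod_(i < n) (i.+1%:R - x).

Definition connector (n m : nat) : R := rfact n * rfact m / rfact (n + m).

(* The head of the word acts last: [true] sums over a < n with weight 1 / (n - x),
   [false] divides by n. *)
Fixpoint word_sum (u : seq bool) (n : nat) : R :=
  match u with
  | [::] => (n == 0%N)%:R
  | true :: u' => (\sum_(a < n) word_sum u' a) / (n%:R - x)
  | false :: u' => word_sum u' n / n%:R
  end.

(** Valued in the extended reals: all terms are nonnegative, so sums can be exchanged before any
    convergence is known. *)
Definition connected_sum (u v : seq bool) : \bar R :=
  (\sum_(n <oo) \sum_(m <oo) (word_sum u n * word_sum v m * connector n m)%:E)%E.

Lemma subSx_gt0 (n : nat) : 0 < n.+1%:R - x.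
Proof. by rewrite subr_gt0 (lt_le_trans x1) // ler1n. Qed.

Lemma rfact_gt0 n : 0 < rfact n.
Proof. by apply: prodr_gt0 => i _; exact: subSx_gt0. Qed.

Lemma connectorC n m : connector n m = connector m n.
Proof. by rewrite /connector addnC [rfact n * _]mulrC. Qed.

Lemma connectorn0 n : connector n 0 = 1.
Proof. by rewrite /connector addn0 {2}/rfact big_ord0 mulr1 divff // gt_eqF ?rfact_gt0. Qed.

Lemma connector_gt0 n m : 0 < connector n m.
Proof. by rewrite divr_gt0 ?mulr_gt0 ?rfact_gt0. Qed.

Lemma connectorS n m : connector n m.+1 =
  connector n m * (m.+1%:R - x) / ((n + m).+1%:R - x).
Proof.
rewrite /connector addnS /rfact !big_ord_recr /=.
rewrite -/(rfact n) -/(rfact m) -/(rfact (n + m)).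
have /gt_eqF/negbT := rfact_gt0 (n + m); have /gt_eqF/negbT := subSx_gt0 (n + m).
by move: (_ - x) (rfact _) => a b a0 b0; field; rewrite a0 b0.
Qed.

(** Since (n + m + 1 - x) - (m + 1 - x) = n, consecutive connectors differ by a multiple [n] of the
    summand; this is what telescopes. *)
Lemma connectorB n m : (0 < n)%N ->
  connector n m.+1 / (m.+1%:R - x) = (connector n m - connector n m.+1) / n%:R.
Proof.
move=> n0; rewrite connectorS.
have H2 : m.+1%:R - x != 0 by rewrite gt_eqF ?subSx_gt0.
have n0' : n%:R != 0 :> R by rewrite pnatr_eq0 -lt0n.
have -> : (n + m).+1%:R = n%:R + m.+1%:R :> R by rewrite -addnS natrD.
have : n%:R + m.+1%:R - x != 0 by rewrite -natrD addnS gt_eqF ?subSx_gt0.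
by move: m.+1%:R n%:R H2 n0' => a b H2 n0' H3; field; rewrite H2 H3 n0'.
Qed.

(** The connector decreases in [n], and for n = 1 it is (1 - x) / (b + 1 - x). The bound makes the
    boundary term of the telescoping sum vanish at infinity. *)
Lemma connector_le n b : (0 < n)%N -> connector n b <= b.+1%:R^-1.
Proof.
case: n => // n _; elim: n => [|n IH].
  rewrite connectorC connectorS connectorn0 mul1r addn0 ler_pdivrMr ?subSx_gt0 //.
  rewrite mulrC ler_pdivlMr ?ltr0Sn // -[b.+1]addn1 natrD.
  by have := mulr_ge0 x0 (ler0n R b); lra.
apply: le_trans IH; rewrite connectorC connectorS [connector b _]connectorC.
rewrite ler_pdivrMr ?subSx_gt0 // (ler_wpM2l (ltW (connector_gt0 _ _))) // lerD2r ler_nat.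
by rewrite ltnS leq_addl.
Qed.

Lemma cvg_connector n : (0 < n)%N -> connector n @ \oo --> (0 : R).
Proof.
move=> n0; apply: (@squeeze_cvgr _ _ _ _ (fun=> 0) (@harmonic R)).
- by near=> b; rewrite ltW ?connector_gt0 //= connector_le.
- exact: cvg_cst.
- exact: cvg_harmonic.
Unshelve. all: by end_near. Qed.

Lemma nneseries_connector n m : (0 < n)%N ->
  (\sum_(b <oo) (if (m < b)%N then connector n b / (b%:R - x) else 0)%:E)%E
  = (connector n m / n%:R)%:E.
Proof.
move=> n0; apply/cvg_lim => //; rewrite -(cvg_shiftn m.+1).
have -> : (fun d => \sum_(0 <= b < d + m.+1)
     (if (m < b)%N then connector n b / (b%:R - x) else 0)%:E)%E
  = (fun d => ((connector n m - connector n (d + m)) / n%:R)%:E).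
  apply/funext => d; rewrite sumEFin; congr EFin.
  elim: d => [|d IH].
    rewrite add0n subrr mul0r big_nat big1 // => i /andP[_ im].
    by rewrite ltnNge -ltnS im.
  rewrite addSn big_nat_recr //= IH ltn_addl // addnS connectorB // addSn; lra.
apply: cvg_EFin; first by near=> d.
have H : (connector n m - connector n (d + m)) / n%:R @[d --> \oo] -->
    (connector n m - 0) / n%:R.
  apply: cvgMl; apply: cvgB; first exact: cvg_cst.
  by rewrite (cvg_shiftn m); exact: cvg_connector.
by rewrite subr0 in H; exact: H.
Unshelve. all: by end_near. Qed.

Lemma word_sum_ge0 u n : 0 <= word_sum u n.
Proof.
elim: u n => [|[] u IH] n /=; first by rewrite ler0n.
  case: n => [|n]; first by rewrite big_ord0 mul0r.
  by rewrite divr_ge0 ?sumr_ge0 // ltW ?subSx_gt0.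
by rewrite divr_ge0.
Qed.

(** Either the inner sum is empty or the convention 0^-1 = 0 applies, so a nonempty word only sees
    positive indices. *)
Lemma word_sum0 u : u != [::] -> word_sum u 0 = 0.
Proof. by case: u => // -[] u _ /=; rewrite ?big_ord0 ?mul0r // invr0 mulr0. Qed.

Lemma connected_term_ge0 u v n m :
  (0 <= (word_sum u n * word_sum v m * connector n m)%:E)%E.
Proof.
rewrite lee_fin; apply: mulr_ge0; last exact/ltW/connector_gt0.
by apply: mulr_ge0; exact: word_sum_ge0.
Qed.

Lemma connected_sumC u v : connected_sum u v = connected_sum v u.
Proof.
rewrite /connected_sum nneseries_interchange.
  apply: eq_eseriesr => n _; apply: eq_eseriesr => m _.
  by rewrite connectorC [word_sum u m * _]mulrC.
by move=> i j; exact: connected_term_ge0.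
Qed.

(* The factor 1 / n on the left is the telescoping sum over b > m of
   connector n b / (b - x) / connector n m, so it becomes a summation on the right. *)
Lemma connected_sum_transport u v : u != [::] ->
  connected_sum (false :: u) v = connected_sum u (true :: v).
Proof.
move=> u0; rewrite /connected_sum; apply: eq_eseriesr => n _; case: n => [|n].
  by rewrite !eseries0 // => m _ _; rewrite word_sum0 ?mul0r.
pose h m b := if (m < b)%N then connector n.+1 b / (b%:R - x) else 0.
have h0 m b : 0 <= h m b.
  rewrite /h; case: ifP => //; case: b => // b _.
  by rewrite divr_ge0 // ltW ?connector_gt0 ?subSx_gt0.
have g0 m b : (0 <= (word_sum v m * h m b)%:E)%E.
  by rewrite lee_fin mulr_ge0 ?word_sum_ge0.
transitivity ((word_sum u n.+1)%:E *
    \sum_(m <oo) \sum_(b <oo) (word_sum v m * h m b)%:E)%E.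
  rewrite -nneseriesZl => [|m _]; last exact: nneseries_ge0.
  apply: eq_eseriesr => m _; rewrite (eq_eseriesr (fun b _ => EFinM _ _)).
  rewrite nneseriesZl; last by move=> b _; rewrite lee_fin.
  by rewrite nneseries_connector // -!EFinM /=; congr EFin; ring.
rewrite nneseries_interchange // -nneseriesZl => [|m _]; last exact: nneseries_ge0.
apply: eq_eseriesr => b _.
rewrite (nneseries_split _ b) // add0n (@eseries0 _ _ b) => [|m bm _]; last first.
  by rewrite /h ltnNge bm mulr0.
rewrite adde0 sumEFin -EFinM; congr EFin.
rewrite big_mkord (eq_bigr (fun m : 'I_b => word_sum v m * (connector n.+1 b / (b%:R - x)))).
  by rewrite -mulr_suml /=; ring.
by move=> m _; rewrite /h ltn_ord.
Qed.

(** The letters of [u] move one by one to the other word, complemented: [false] by transport, [true]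
    by transport read from right to left after exchanging the words. The conditions on the head and
    the last letter ensure that each transport meets the nonempty word it requires. *)
Lemma connected_sum_dual (u v : seq bool) :
  (v != [::]) || ~~ head true u -> last true u ->
  connected_sum u v = connected_sum [::] (catrev (map negb u) v).
Proof.
elim: u v => // c u IH v /= cv lu.
case: c cv lu => /= cv lu; last first.
  by case: u lu IH => // a u lu IH; rewrite connected_sum_transport // IH.
rewrite orbF in cv.
by rewrite connected_sumC -connected_sum_transport // connected_sumC IH.
Qed.

Lemma connected_sum_nil u : connected_sum u [::] = (\sum_(n <oo) (word_sum u n)%:E)%E.
Proof.
apply: eq_eseriesr => n _.
rewrite (nneseries_split _ 1) // => [|m _]; last exact: connected_term_ge0.
rewrite big_nat1 eseries0 => [|[|m]//=]; last by rewrite mulr0 mul0r.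
by rewrite adde0 connectorn0 /= !mulr1.
Qed.

Lemma word_sum_dual (u : seq bool) : ~~ head true u -> last true u ->
  (\sum_(n <oo) (word_sum u n)%:E = \sum_(n <oo) (word_sum (rev (map negb u)) n)%:E)%E.
Proof.
move=> hu lu; rewrite -!connected_sum_nil connected_sum_dual ?hu //.
by rewrite connected_sumC.
Qed.

End ConnectedSum.

(** * Indices as words *)

(** The usual two-letter encoding of multiple zeta values: duality becomes reversal combined with
    exchange of letters. It is fed to [word_sum] reversed, because there the head acts last. *)
Definition index_word (k : seq nat) : seq bool :=
  flatten [seq true :: nseq j.-1 false | j <- k].

Lemma index_word_blocks (ab : seq (nat * nat)) : pos_blocks ab ->
  index_word (index_of_blocks ab) =
  flatten [seq nseq p.1 true ++ nseq p.2 false | p <- ab].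
Proof.
case/andP => _; rewrite /index_word /index_of_blocks.
elim: ab => //= -[a b] ab IH /= /andP[/andP[a0 _] /IH {}IH].
rewrite map_cat flatten_cat IH map_rcons -cats1 flatten_cat /= cats0.
congr (_ ++ _); case: a a0 => // a _ /=; by elim: a => //= a ->.
Qed.

Lemma index_word_dual (k : seq nat) : admissible k ->
  index_word (dual_index k) = rev (map negb (index_word k)).
Proof.
move=> /blocksK[kpos kE]; rewrite -{2}kE /dual_index !index_word_blocks //; last first.
  case/andP: kpos => k0 kpos; rewrite /pos_blocks size_rev size_map k0 all_rev all_map.
  by apply: sub_all kpos => p /=; rewrite andbC.
elim: (blocks k) => //= -[a b] ab IH.
rewrite rev_cons map_rcons flatten_rcons IH map_cat rev_cat; congr (_ ++ _).
by rewrite map_cat rev_cat !map_nseq !rev_nseq.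
Qed.

Lemma head_rev_index_word (k : seq nat) : admissible k ->
  ~~ head true (rev (index_word k)).
Proof.
rewrite /admissible => /andP[_]; case/lastP: k => // k j; rewrite last_rcons => j1.
rewrite /index_word map_rcons flatten_rcons rev_cat.
by case: j j1 => [|[|j]] // _; rewrite -cat1s rev_cat rev_nseq.
Qed.

Lemma last_rev_index_word (k : seq nat) : admissible k ->
  last true (rev (index_word k)).
Proof. by case: k => // j k _; rewrite /index_word /= rev_cons last_rcons. Qed.

(** The empty tuple counts as ending in 0, hence is listed only when M > 0; this matches [word_sum]
    of the empty word, which is concentrated at 0. *)
Fixpoint increasing_below (r M : nat) : seq (seq nat) :=
  match r with
  | 0 => if M == 0%N then [::] else [:: [::]]
  | r'.+1 => flatten [seq [seq rcons s N | s <- increasing_below r' N] | N <- iota 0 M]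
  end.

Lemma mem_increasing_below r M s : (s \in increasing_below r M) =
  [&& size s == r, path ltn 0%N s & (last 0%N s < M)%N].
Proof.
elim: r M s => [|r IH] M s /=.
  by case: M => [|M]; case: s => //= n s; rewrite !andbF.
apply/flatten_mapP/and3P => [[N]|[]].
  rewrite mem_iota /= add0n => NM /mapP[t]; rewrite IH => /and3P[/eqP tr pt tN] ->.
  by rewrite size_rcons tr rcons_path pt last_rcons.
case/lastP: s => // s N; rewrite size_rcons eqSS rcons_path last_rcons.
move=> sr /andP[ps sN] NM; exists N; first by rewrite mem_iota.
by apply: map_f; rewrite IH sr ps.
Qed.

Lemma uniq_increasing_below r M : uniq (increasing_below r M).
Proof.
elim: r M => [|r IH] M /=; first by case: M.
elim: M => // M IHM; rewrite -addn1 iotaD map_cat flatten_cat cat_uniq IHM /= cats0.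
rewrite map_inj_uniq ?IH ?andbT; last by move=> s t /rcons_inj[].
apply/hasPn => _ /mapP[t _ ->]; apply/negP => /flatten_mapP[N].
rewrite mem_iota /= add0n => NM /mapP[t' _] /(congr1 (last 0%N)).
by rewrite !last_rcons => NE; move: NM; rewrite -NE ltnn.
Qed.

(** * The multiple series of an index as a word sum *)

Section IndexSum.
Variables (R : realType) (x : R).

Lemma sum_increasing_below (k : seq nat) M :
  \sum_(s <- increasing_below (size k) M)
    \prod_(j < size k) (((nth 0%N s j)%:R ^+ (nth 0%N k j).-1 * ((nth 0%N s j)%:R - x))^-1)
  = \sum_(a < M) word_sum x (rev (index_word k)) a.
Proof.
elim/last_ind: k M => [|k m IH] M.
  case: M => [|M] /=; first by rewrite big_nil big_ord0.
  by rewrite big_seq1 big_ord0 big_ord_recl /= big1 ?addr0.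
rewrite size_rcons /= big_flatten big_map -[M in iota 0 M]subn0 -/(index_iota 0 M) big_mkord.
apply: eq_bigr => N _; rewrite big_map.
(* The new last entry [m] puts [m.-1] letters [false] and then one [true] in front of the reversed
   word; these produce the factors in the largest variable [N]. *)
have -> : word_sum x (rev (index_word (rcons k m))) N =
    (\sum_(a < N) word_sum x (rev (index_word k)) a) * (N%:R ^+ m.-1 * (N%:R - x))^-1.
  rewrite /index_word map_rcons flatten_rcons rev_cat -cat1s rev_cat rev_nseq /=.
  rewrite -catA; elim: m.-1 => [|i IHi] /=; first by rewrite expr0 mul1r.
  by rewrite IHi exprS -mulrA !invfM; ring.
rewrite -IH mulr_suml big_seq [RHS]big_seq; apply: eq_bigr => s.
rewrite mem_increasing_below => /and3P[/eqP sk _ _].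
rewrite big_ord_recr /= !nth_rcons sk ltnn eqxx; congr (_ * _).
by apply: eq_bigr => j _; rewrite !nth_rcons sk ltn_ord.
Qed.

Lemma index_sum_word_sum (k : seq nat) (l : R) : 0 <= x -> x < 1 ->
  has_sum [set n : (size k).-tuple nat | path ltn 0%N n]
    (fun n => (\prod_(j < size k)
       (((tnth n j)%:R ^+ (nth 0%N k j).-1 * ((tnth n j)%:R - x))^-1))%:C%C) l%:C%C ->
  (\sum_(n <oo) (word_sum x (rev (index_word k)) n)%:E = l%:E)%E.
Proof.
move=> x0 x1 kl.
(* The increasing tuples with last entry below [M] exhaust the index set. *)
pose B M : {fset (size k).-tuple nat} :=
  [fset n in pmap insub (increasing_below (size k) M)]%fset.
have mB M n : (n \in B M) = path ltn 0%N n && (last 0%N n < M)%N.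
  rewrite /B !inE mem_pmap_sub /= mem_increasing_below size_tuple eqxx //.
have sB (F : seq nat -> R) M : \sum_(n <- B M) F n = \sum_(s <- increasing_below (size k) M) F s.
  rewrite -(big_map val xpredT F); apply/perm_big/uniq_perm.
  - by rewrite map_inj_uniq ?fset_uniq //; exact: val_inj.
  - exact: uniq_increasing_below.
  move=> s; rewrite mem_increasing_below; apply/mapP/and3P.
    by move=> [n]; rewrite mB => /andP[pn ln ->]; rewrite size_tuple.
  by move=> [ss ps ls]; exists (Tuple ss); rewrite ?mB ?ps.
apply/cvg_lim => //.
have BP M : [set` B M] `<=` [set n | path ltn 0%N n].
  by move=> n /=; rewrite mB => /andP[].
have exB (n : (size k).-tuple nat) : path ltn 0%N n ->
    exists M0, forall M, (M0 <= M)%N -> n \in B M.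
  by move=> pn; exists (last 0%N n).+1 => M nM; rewrite mB pn.
have := has_sum_cvg kl BP exB.
set F := fun M : nat => _; move=> kcvg.
suff -> : (fun M => \sum_(0 <= n < M) (word_sum x (rev (index_word k)) n)%:E)%E = EFin \o F.
  by apply: cvg_EFin => //; exact: nearW.
apply/funext => M; rewrite sumEFin /= big_mkord -sum_increasing_below.
rewrite -(sB (fun s => \prod_(j < size k)
  ((nth 0%N s j)%:R ^+ (nth 0%N k j).-1 * ((nth 0%N s j)%:R - x))^-1)).
by congr EFin; apply: eq_bigr => n _; apply: eq_bigr => j _; rewrite (tnth_nth 0%N).
Qed.

Lemma index_sum_dual (k : seq nat) (l l' : R) : 0 <= x -> x < 1 -> admissible k ->
  has_sum [set n : (size k).-tuple nat | path ltn 0%N n]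
    (fun n => (\prod_(j < size k)
       (((tnth n j)%:R ^+ (nth 0%N k j).-1 * ((tnth n j)%:R - x))^-1))%:C%C) l%:C%C ->
  has_sum [set n : (size (dual_index k)).-tuple nat | path ltn 0%N n]
    (fun n => (\prod_(j < size (dual_index k))
       (((tnth n j)%:R ^+ (nth 0%N (dual_index k) j).-1 * ((tnth n j)%:R - x))^-1))%:C%C)
    l'%:C%C -> l = l'.
Proof.
move=> x0 x1 kadm /(index_sum_word_sum x0 x1) kl /(index_sum_word_sum x0 x1) kl'.
apply: EFin_inj; rewrite -kl -kl' word_sum_dual ?head_rev_index_word ?last_rev_index_word //.
by rewrite index_word_dual // map_rev revK.
Qed.
End IndexSum.

(** * Absolute convergence *)

Section Majorant.
Variables (R : realType) (r : nat).
Hypothesis r0 : (0 < r)%N.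

Definition nroot (m : nat) : R := m%:R `^ r%:R^-1.

Lemma nroot_gt0 m : (0 < m)%N -> 0 < nroot m.
Proof. by move=> m0; rewrite powR_gt0 // ltr0n. Qed.

Lemma nrootX m : nroot m ^+ r = m%:R.
Proof.
rewrite /nroot -powR_mulrn ?powR_ge0 // -powRrM mulVf ?powRr1 //.
by rewrite pnatr_eq0 -lt0n.
Qed.

Lemma ler_nroot m n : (m <= n)%N -> nroot m <= nroot n.
Proof. by move=> mn; rewrite ge0_ler_powR ?nnegrE ?ler_nat ?invr_ge0. Qed.

Definition weight (m : nat) : R := (m%:R * nroot m)^-1.

Lemma weight_ge0 m : 0 <= weight m.
Proof. by rewrite invr_ge0 mulr_ge0 // powR_ge0. Qed.

Lemma weight0 : weight 0 = 0.
Proof. by rewrite /weight mul0r invr0. Qed.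

(** With u and v the r-th roots of m and m + 1, one has 1 = v^r - u^r <= (v - u) r v^(r-1); dividing
    by v^(r+1) gives 1 / v^(r+1) <= r (v - u) / v^2 <= r (1/u - 1/v). *)
Lemma weightS_le m : (0 < m)%N ->
  weight m.+1 <= r%:R * ((nroot m)^-1 - (nroot m.+1)^-1).
Proof.
move=> m0.
have u0 := nroot_gt0 m0; have v0 : 0 < nroot m.+1 by exact: nroot_gt0.
have uv : nroot m <= nroot m.+1 by exact: ler_nroot.
have : 1 <= (nroot m.+1 - nroot m) * (r%:R * nroot m.+1 ^+ r.-1).
  have one : 1 = nroot m.+1 ^+ r - nroot m ^+ r by rewrite !nrootX -natr1; lra.
  rewrite [leLHS]one subrXX ler_wpM2l ?subr_ge0 // mulr_natl -[X in _ *+ X]card_ord -sumr_const.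
  apply: ler_sum => i _; have ir : (i <= r.-1)%N by have := ltn_ord i; lia.
  rewrite -[X in _ <= _ ^+ X](subnK ir) exprD.
  by rewrite ler_wpM2l ?exprn_ge0 ?lerXn2r ?nnegrE ?powR_ge0.
move=> H; rewrite /weight -[X in X * nroot _]nrootX -[X in _ ^+ X](prednK r0) exprS.
move: (nroot m) (nroot m.+1) u0 v0 uv (r.-1) (r%:R : R) H => u v u0 v0 uv p q H.
have -> : q * (u^-1 - v^-1) = q * (v - u) / (u * v) by field; rewrite !gt_eqF.
have vp0 : 0 < v ^+ p by exact: exprn_gt0.
rewrite -div1r ler_pdivrMr ?mulr_gt0 // mulrAC ler_pdivlMr ?mulr_gt0 // mul1r.
have -> : q * (v - u) * (v * v ^+ p * v) = (v - u) * (q * v ^+ p) * (v * v) by ring.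
apply: le_trans (_ : 1 * (v * v) <= _).
  by rewrite mul1r ler_wpM2r // ltW.
by rewrite ler_wpM2r // mulr_ge0 // ltW.
Qed.

Lemma sum_weight_le M : \sum_(m < M) weight m <= r.+1%:R.
Proof.
suff H : \sum_(m < M.+2) weight m <= 1 + r%:R * (1 - (nroot M.+1)^-1).
  have : \sum_(m < M) weight m <= \sum_(m < M.+2) weight m.
    by rewrite !big_ord_recr /= -addrA lerDl addr_ge0 ?weight_ge0.
  move=> /le_trans; apply; apply: (le_trans H).
  rewrite -natr1 addrC lerD2r -[leRHS]mulr1 ler_wpM2l // lerBlDr lerDl.
  by rewrite invr_ge0 ltW ?nroot_gt0.
elim: M => [|M IH].
  rewrite !big_ord_recr big_ord0 /= weight0 !add0r /weight /nroot powR1.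
  by rewrite invr1 subrr mulr0 addr0 mulr1 invr1.
rewrite big_ord_recr /=; apply: (le_trans (lerD IH (weightS_le _))) => //.
rewrite -addrA lerD2l -mulrDr ler_wpM2l //; lra.
Qed.

Definition ndist (a b : nat) : nat := ((a - b) + (b - a))%N.

(** Each side of [N] contributes at most one full sum of weights, and the diagonal term is 0 by
    [weight0]. *)
Lemma sum_weight_ndist_le M N : \sum_(a < M) weight (ndist a N) <= (2 * r.+1)%:R.
Proof.
apply: (@le_trans _ _ (\sum_(a < M) weight (a - N) + \sum_(a < M) weight (N - a))).
  rewrite -big_split /=; apply: ler_sum => a _; rewrite /ndist.
  have [aN|/ltnW Na] := leqP a N.
    by rewrite (eqP aN) add0n lerDr weight_ge0.
  by rewrite (eqP Na) addn0 lerDl weight_ge0.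
rewrite mul2n -addnn natrD; apply: lerD.
  apply: le_trans (sum_weight_le M).
  rewrite -(big_mkord xpredT weight) -(big_mkord xpredT (fun a => weight (a - N))).
  elim: N => [|N IH]; first by rewrite (eq_bigr weight) // => i _; rewrite subn0.
  apply: le_trans IH.
  case: M => [|M]; first by rewrite !big_nil.
  rewrite big_nat_recl // sub0n weight0 add0r big_nat_recr //=.
  by rewrite (eq_bigr (fun i => weight (i - N))) ?lerDl ?weight_ge0.
apply: le_trans (sum_weight_le N.+1).
elim: N M => [|N IH] [|M].
- by rewrite big_ord0 big_ord_recl big_ord0 weight0 addr0.
- by rewrite big1 => [|i _]; rewrite ?sub0n ?weight0 // big_ord_recl big_ord0 weight0 addr0.
- by rewrite big_ord0 sumr_ge0 // => i _; exact: weight_ge0.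
rewrite big_ord_recl subn0 [leRHS]big_ord_recr /= addrC lerD2l.
apply: le_trans (IH M); apply: ler_sum => i _.
by rewrite /bump /= add1n subSS.
Qed.

Definition majorant (n : 'I_r -> nat) (i : 'I_r) : R :=
  weight (n i) * \prod_(j < r | j != i) weight (ndist (n j) (n i)).

Lemma majorant_ge0 n i : 0 <= majorant n i.
Proof. by rewrite mulr_ge0 ?weight_ge0 // prodr_ge0 // => j _; exact: weight_ge0. Qed.

(** Once the ordering of the entries is dropped and n_i is fixed, the sum factors into r - 1
    independent sums over the distances to n_i. *)
Lemma sum_ffun_majorant_le (i : 'I_r) M :
  \sum_(f : {ffun 'I_r -> 'I_M}) majorant (fun j => f j) i
  <= r.+1%:R * (2 * r.+1)%:R ^+ r.-1.
Proof.
rewrite /majorant (partition_big (fun f : {ffun 'I_r -> 'I_M} => f i) xpredT) //=.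
apply: (@le_trans _ _ (\sum_(N < M) weight N * (2 * r.+1)%:R ^+ r.-1)); last first.
  by rewrite -mulr_suml ler_wpM2r ?exprn_ge0 // sum_weight_le.
apply: ler_sum => N _.
(* The indicator in the factor [i] turns the sum over [f] with f(i) = N into a sum over all [f], to
   which distributivity applies. *)
pose F j (a : 'I_M) := if j == i then (a == N)%:R * weight N else weight (ndist a N).
rewrite (_ : \sum_(_ | _) _ = \sum_(f : {ffun 'I_r -> 'I_M}) \prod_(j < r) F j (f j)).
  rewrite -bigA_distr_bigA (bigD1 i) //=; apply: ler_pM.
  - apply: sumr_ge0 => a _.
    by rewrite /F eqxx mulr_ge0 ?weight_ge0 // ler0n.
  - apply: prodr_ge0 => j ji; apply: sumr_ge0 => a _.
    by rewrite /F (negPf ji) weight_ge0.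
  - rewrite /F eqxx (bigD1 N) //= eqxx mul1r big1 ?addr0 // => a /negPf ->.
    by rewrite mul0r.
  have -> : r.-1 = #|[pred j : 'I_r | j != i]|.
    by rewrite -[RHS]/#|predC1 i| cardC1 card_ord.
  rewrite -prodr_const; apply: ler_prod => j ji.
  rewrite sumr_ge0 => [|a _]; last by rewrite /F (negPf ji) weight_ge0.
  rewrite /F (negPf ji) /=; exact: sum_weight_ndist_le.
rewrite [RHS](bigID (fun f : {ffun 'I_r -> 'I_M} => f i == N)) /= [X in _ = _ + X]big1 => [|f fN].
  rewrite addr0; apply: eq_bigr => f /eqP fN; rewrite [RHS](bigD1 i) //= {1}/F !fN !eqxx mul1r.
  by congr (_ * _); apply: eq_bigr => j /negPf ji; rewrite /F ji.
by rewrite (bigD1 i) //= {1}/F eqxx (negPf fN) !mul0r.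
Qed.

Lemma sum_majorant_le (i : 'I_r) (B : {fset r.-tuple nat}) :
  \sum_(n <- B) majorant (tnth n) i <= r.+1%:R * (2 * r.+1)%:R ^+ r.-1.
Proof.
pose M := \max_(n <- B) \max_(j < r) tnth n j.
have BM n j : n \in B -> (tnth n j <= M)%N.
  move=> nB; apply: leq_trans (leq_bigmax_seq _ nB _) => //.
  exact: (leq_bigmax j).
apply: le_trans (sum_ffun_majorant_le i M.+1).
pose phi (n : r.-tuple nat) : {ffun 'I_r -> 'I_M.+1} := [ffun j => inord (tnth n j)].
have phiE n j : n \in B -> phi n j = tnth n j :> nat.
  by move=> nB; rewrite ffunE inordK // ltnS BM.
rewrite (eq_big_seq (fun n => majorant (fun j => phi n j) i)) => [|n nB]; last first.
  by rewrite /majorant phiE //; congr (_ * _); apply: eq_bigr => j _; rewrite phiE.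
rewrite -(big_map phi xpredT (fun f : {ffun 'I_r -> 'I_M.+1} => majorant (fun j => f j) i)).
rewrite big_uniq /=; last first.
  rewrite map_inj_in_uniq ?fset_uniq // => m n mB nB mn; apply: eq_from_tnth => j.
  by rewrite -!phiE // mn.
rewrite [leRHS](bigID (mem (map phi B))) /= lerDl sumr_ge0 // => f _.
exact: majorant_ge0.
Qed.

End Majorant.

(** * Termwise bound for the interpolated series *)

Section Coefficient.
Variable R : realType.

Definition coef (k : seq nat) (i : 'I_(size k)) (n : (size k).-tuple nat) : R :=
  (\prod_(j < size k) (tnth n j)%:R ^+ nth 0%N k j)^-1 *
  \prod_(j < size k | j != i) ((tnth n j)%:R / ((tnth n j)%:R - (tnth n i)%:R)).

Lemma path_ltn_tnth r (n : r.-tuple nat) (i j : 'I_r) : path ltn 0%N n ->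
  (i < j)%N -> (tnth n i < tnth n j)%N.
Proof.
move=> /path_sorted sn ij; rewrite !(tnth_nth 0%N).
by apply: (sorted_ltn_nth ltn_trans) => //; rewrite inE size_tuple.
Qed.

Lemma path_ltn_tnth_gt0 r (n : r.-tuple nat) (i : 'I_r) : path ltn 0%N n ->
  (0 < tnth n i)%N.
Proof.
move=> pn; have := order_path_min ltn_trans pn.
by move=> /allP; apply; exact: mem_tnth.
Qed.

Lemma path_ltn_tnth_neq r (n : r.-tuple nat) (i j : 'I_r) : path ltn 0%N n ->
  j != i -> tnth n j != tnth n i.
Proof.
move=> pn; rewrite -(inj_eq val_inj) neq_ltn /= => /orP[|] /(path_ltn_tnth pn);
  rewrite neq_ltn => -> //.
by rewrite orbT.
Qed.

(* The r numbers n_i and |n_j - n_i| are at most the last entry of n, hence so is the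
   product of their r-th roots: one factor 1 / n_r upgrades every 1 / m to the summable
   m^(-1 - 1/r). *)
Lemma normr_coef_le (k : seq nat) (i : 'I_(size k)) (n : (size k).-tuple nat) :
  admissible k -> path ltn 0%N n -> `|coef i n| <= majorant R (tnth n) i.
Proof.
move=> /andP[/andP[k0 /allP kpos] klast] pn.
have L0 : ((size k).-1 < size k)%N by rewrite prednK.
pose L := Ordinal L0.
have leL j : (tnth n j <= tnth n L)%N.
  have : (j <= L)%N by rewrite /= -ltnS prednK.
  by rewrite leq_eqVlt => /orP[/eqP/val_inj -> //|/(path_ltn_tnth pn)/ltnW].
have n0 j : 0 < (tnth n j)%:R :> R by rewrite ltr0n path_ltn_tnth_gt0.
have d0 j : j != i -> (0 < ndist (tnth n j) (tnth n i))%N.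
  by move=> /(path_ltn_tnth_neq pn); rewrite /ndist; lia.
have dL j : (ndist (tnth n j) (tnth n i) <= tnth n L)%N.
  by have := leL j; have := leL i; rewrite /ndist; lia.
have dE j : `|(tnth n j)%:R - (tnth n i)%:R| = (ndist (tnth n j) (tnth n i))%:R :> R.
  rewrite /ndist; have [ji|/ltnW ji] := leqP (tnth n j) (tnth n i).
    by rewrite distrC -natrB // ger0_norm ?ler0n // (eqP ji).
  by rewrite -natrB // ger0_norm ?ler0n // (eqP ji) addn0.
pose P : R := \prod_(j < size k | j != i) (ndist (tnth n j) (tnth n i))%:R^-1.
have P0 : 0 <= P by apply: prodr_ge0 => j _; rewrite invr_ge0.
(* Admissibility enters here: the last exponent is at least 2 and the others at least 1, so the
   denominator contains the last entry once more than the full product of the n_j. *)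
have step1 : `|coef i n| <= ((tnth n i)%:R * (tnth n L)%:R)^-1 * P.
  pose A : R := \prod_(j < size k | j != i) (tnth n j)%:R.
  have A0 : 0 < A by exact: prodr_gt0.
  have -> : `|coef i n| = (\prod_(j < size k) (tnth n j)%:R ^+ nth 0%N k j)^-1 * (A * P).
    have Q0 : 0 <= \prod_(j < size k) (tnth n j)%:R ^+ nth 0%N k j :> R.
      by apply: prodr_ge0 => j _; rewrite exprn_ge0.
    rewrite normrM normfV (ger0_norm Q0) normr_prod.
    rewrite -big_split /=; congr (_ * _); apply: eq_bigr => j _.
    by rewrite normf_div dE ger0_norm.
  rewrite mulrA ler_wpM2r // -[leRHS](divfK (lt0r_neq0 A0)) -invfM.
  have Q0 : 0 < \prod_(j < size k) (tnth n j)%:R ^+ nth 0%N k j :> R.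
    by apply: prodr_gt0 => j _; rewrite exprn_gt0.
  rewrite ler_wpM2r ?(ltW A0) // lef_pV2 ?posrE ?mulr_gt0 //.
  have -> : (tnth n i)%:R * (tnth n L)%:R * A = (tnth n L)%:R * \prod_(j < size k) (tnth n j)%:R.
    by rewrite [in RHS](bigD1 i) //= -/A mulrCA mulrA.
  rewrite (bigD1 L) //= [leRHS](bigD1 L) //= mulrA.
  have ge1 j : 1 <= (tnth n j)%:R :> R by rewrite ler1n -(ltr0n R).
  have kL : (1 < nth 0%N k (size k).-1)%N by rewrite nth_last.
  apply: ler_pM.
  - by rewrite mulr_ge0.
  - exact: prodr_ge0.
  - by rewrite -expr2 ler_weXn2l.
  apply: ler_prod => j _; rewrite ler0n /= -[leLHS]expr1 ler_weXn2l //.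
  by apply: kpos; rewrite mem_nth.
have step2 : (tnth n L)%:R^-1 * P <= (nroot R (size k) (tnth n i))^-1 *
    \prod_(j < size k | j != i) weight R (size k) (ndist (tnth n j) (tnth n i)).
  have E : \prod_(j < size k | j != i) weight R (size k) (ndist (tnth n j) (tnth n i)) =
      P * (\prod_(j < size k | j != i) nroot R (size k) (ndist (tnth n j) (tnth n i)))^-1.
    by rewrite -prodfV -big_split; apply: eq_bigr => j _; rewrite /weight invfM.
  rewrite E mulrCA -invfM mulrC ler_wpM2l // lef_pV2 ?posrE //; last first.
    rewrite mulr_gt0 ?nroot_gt0 ?path_ltn_tnth_gt0 //.
    by apply: prodr_gt0 => j /d0; exact: nroot_gt0.
  rewrite -(nrootX R k0) -[X in _ ^+ X]card_ord -prodr_const [leRHS](bigD1 i) //=.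
  apply: ler_pM; rewrite ?powR_ge0 ?ler_nroot //.
    by apply: prodr_ge0 => j _; rewrite powR_ge0.
  by apply: ler_prod => j _; rewrite powR_ge0 ler_nroot.
apply: (le_trans step1); rewrite invfM -mulrA /majorant {1}/weight invfM -mulrA.
by rewrite ler_wpM2l // invr_ge0.
Qed.
End Coefficient.

(** * Partial fractions *)

(** Lagrange interpolation of the constant 1: the interpolant minus 1 has degree below r and
    vanishes at the r nodes. *)
Lemma lagrange_one (K : fieldType) r (y : 'I_r -> K) (x : K) : (0 < r)%N ->
  injective y -> \sum_(i < r) \prod_(j < r | j != i) ((y j - x) / (y j - y i)) = 1.
Proof.
move=> r0 yinj.
pose q i : {poly K} := \prod_(j < r | j != i) ((y j - y i)^-1 *: ((y j)%:P - 'X)).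
have qE i z : (q i).[z] = \prod_(j < r | j != i) ((y j - z) / (y j - y i)).
  by rewrite /q horner_prod; apply: eq_bigr => j _; rewrite !hornerE mulrC.
have -> : \sum_(i < r) \prod_(j < r | j != i) ((y j - x) / (y j - y i)) =
    (\sum_(i < r) q i).[x].
  by rewrite horner_sum; apply: eq_bigr => i _; rewrite qE.
suff /eqP : (\sum_(i < r) q i) - 1 = 0 by rewrite subr_eq0 => /eqP ->; rewrite hornerE.
apply: (@roots_geq_poly_eq0 _ _ [seq y i | i <- enum 'I_r]).
- apply/allP => _ /mapP[l _ ->]; rewrite rootE !hornerE horner_sum.
  rewrite (bigD1 l) //= qE big1 ?add0r => [|j jl].
    rewrite big1 ?addr0 => [|i il]; first by rewrite subrr.
    by rewrite qE (bigD1 l) 1?eq_sym //= subrr !mul0r.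
  by rewrite divff // subr_eq0 (inj_eq yinj).
- by rewrite map_inj_uniq // enum_uniq.
rewrite size_map size_enum_ord.
have le_size i : (size (q i) <= r)%N.
  apply: leq_trans (size_poly_prod_leq _ _) _.
  have cP : #|[pred j : 'I_r | j != i]| = r.-1 by rewrite -[LHS]/#|predC1 i| cardC1 card_ord.
  have : (\sum_(j < r | j != i) size ((y j - y i)^-1 *: ((y j)%:P - 'X)) <= r.-1 * 2)%N.
    rewrite -cP -sum_nat_const; apply: leq_sum => j _.
    apply: leq_trans (size_scale_leq _ _) _.
    by rewrite -opprB size_polyN size_XsubC.
  by rewrite cP; move: (\sum_(j < r | _) _)%N => S; lia.
rewrite (leq_trans (size_polyD _ _)) // geq_max size_polyN size_poly1 r0 andbT.
by apply: (leq_trans (size_sum _ _ _)); apply/bigmax_leqP => i _.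
Qed.

Lemma partial_fractions (K : fieldType) r (y : 'I_r -> K) (x : K) : (0 < r)%N ->
  injective y -> (forall j, y j != x) ->
  \sum_(i < r) y i / (y i - x) * \prod_(j < r | j != i) (y j / (y j - y i)) =
  \prod_(j < r) (y j / (y j - x)).
Proof.
move=> r0 yinj yx; transitivity (\prod_(j < r) (y j / (y j - x)) *
    \sum_(i < r) \prod_(j < r | j != i) ((y j - x) / (y j - y i))); last first.
  by rewrite lagrange_one ?mulr1.
rewrite mulr_sumr.
apply: eq_bigr => i _; rewrite [in RHS](bigD1 i) //= -[RHS]mulrA; rewrite -big_split /=.
congr (_ * _); apply: eq_bigr => j ji.
have H1 : y j - x != 0 by rewrite subr_eq0.
have H2 : y j - y i != 0 by rewrite subr_eq0 (inj_eq yinj).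
by move: (y j) (y i) H1 H2 => a b H1 H2; field; rewrite H1 H2.
Qed.

(** * Functionals annihilating n / (n - x) *)

Section Functional.
Variable R : realType.
Local Notation C := R[i]^o.
Implicit Types phi psi : nat -> C.

Definition seq_bounded phi := exists M : R, forall n, (0 < n)%N -> `|phi n| <= M%:C%C.

Lemma normr_cexp (z : C) : `|cexp z| = (expR (complex.Re z))%:C%C.
Proof.
rewrite /cexp normrM !normc_def /= expr0n /= addr0 sqrtr_sqr cos2Dsin2 sqrtr1 mulr1.
by rewrite ger0_norm // expR_ge0.
Qed.

Lemma normr_cpow n (s : C) : `|cpow n s| = (expR (complex.Re s * ln n%:R))%:C%C.
Proof. by rewrite normr_cexp; case: s => a b /=; rewrite mulr0 subr0. Qed.

Variables (L : (nat -> C) -> C) (K : R).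
Hypothesis L_lin : forall phi psi c, seq_bounded phi -> seq_bounded psi ->
  L (fun n => phi n + c * psi n) = L phi + c * L psi.
Hypothesis L_bound : forall phi M, (forall n, (0 < n)%N -> `|phi n| <= M%:C%C) ->
  `|L phi| <= (K * M)%:C%C.

Definition killed phi := seq_bounded phi /\ L phi = 0.

Lemma seq_boundedD phi psi c : seq_bounded phi -> seq_bounded psi ->
  seq_bounded (fun n => phi n + c * psi n).
Proof.
move=> [M HM] [N HN]; exists (M + complex.Re `|c| * N) => n n0.
apply: le_trans (ler_normD _ _) _; rewrite rmorphD /= lerD ?HM // normrM rmorphM /=.
have -> : (complex.Re `|c|)%:C%C = `|c| by rewrite normc_def.
by rewrite ler_wpM2l ?HN.
Qed.

Lemma killedD phi psi c : killed phi -> killed psi -> killed (fun n => phi n + c * psi n).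
Proof.
move=> [bp kp] [bq kq]; split; first exact: seq_boundedD.
by rewrite L_lin // kp kq mulr0 addr0.
Qed.

(** The kernel of a bounded functional is closed for the sup norm over n > 0. *)
Lemma killed_lim phi :
  (forall e : R, 0 < e -> exists2 psi, killed psi &
     forall n, (0 < n)%N -> `|phi n - psi n| <= e%:C%C) -> killed phi.
Proof.
move=> H; have bphi : seq_bounded phi.
  have [psi [[M HM] _] Hpsi] := H 1 ltr01; exists (1 + M) => n n0.
  rewrite -[phi n](subrK (psi n)); apply: le_trans (ler_normD _ _) _.
  by rewrite rmorphD lerD ?HM ?Hpsi.
split=> //; apply/eqP; rewrite -normr_le0; apply/ler_addgt0Pr => e e0; rewrite add0r.
have [r r0 ->] : exists2 r : R, 0 < r & e = r%:C%C.
  by case: e e0 => a b; rewrite ltcE /= => /andP[/eqP -> a0]; exists a.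
(* A positive substitute for [K], whose sign is not given, so that division is possible. *)
pose K' := `|K| + 1; have K'0 : 0 < K' by rewrite ltr_wpDl.
have [psi [bpsi kpsi] Hpsi] := H (r / K') (divr_gt0 r0 K'0).
have -> : L phi = L (fun n => phi n + (-1) * psi n).
  by rewrite L_lin // kpsi mulr0 addr0.
apply: le_trans (L_bound (M := r / K') _) _ => [n n0|].
  by rewrite mulN1r Hpsi.
rewrite lecR mulrA ler_pdivrMr // mulrC ler_wpM2l ?(ltW r0) //.
by rewrite (le_trans (ler_norm _)) // lerDl.
Qed.

Lemma killed_ext phi psi : killed phi -> (forall n, (0 < n)%N -> phi n = psi n) ->
  killed psi.
Proof.
move=> kphi pq; apply: killed_lim => e e0; exists phi => // n n0.
by rewrite pq // subrr normr0 lecR ltW.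
Qed.

Lemma killed0 : killed (fun=> 0).
Proof.
split; first by exists 0 => n _; rewrite normr0.
apply/eqP; rewrite -normr_le0; have := L_bound (phi := fun=> 0) (M := 0) _.
by rewrite mulr0; apply => n _; rewrite normr0.
Qed.

Lemma killed_sum J (c : nat -> C) (F : nat -> nat -> C) :
  (forall j, (j < J)%N -> killed (F j)) -> killed (fun n => \sum_(j < J) c j * F j n).
Proof.
elim: J => [|J IH] FJ.
  by apply: killed_ext killed0 _ => n _; rewrite big_ord0.
have kJ : killed (fun n => \sum_(j < J) c j * F j n) by apply: IH => j jJ; apply: FJ; lia.
apply: killed_ext (killedD (c J) kJ (FJ J _)) _ => // n _.
by rewrite big_ord_recr.
Qed.

Hypothesis L_kernel : forall x : R, 0 < x -> x <= 2^-1 ->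
  L (fun n => (n%:R / (n%:R - x))%:C%C) = 0.

Lemma kernel_le (n : nat) (x : R) : (0 < n)%N -> 0 < x -> x <= 2^-1 ->
  0 < n%:R - x /\ 0 <= n%:R / (n%:R - x) - 1 <= 2 * x.
Proof.
move=> n0 x0 x2; have n1 : 1 <= n%:R :> R by rewrite ler1n.
have d0 : 0 < n%:R - x by lra.
have -> : n%:R / (n%:R - x) - 1 = x / (n%:R - x).
  by move: (n%:R) d0 => a d0; field; rewrite gt_eqF.
split=> //; rewrite divr_ge0 ?(ltW x0) ?(ltW d0) //= ler_pdivrMr //; nra.
Qed.

Lemma invXn_le1 m n : (0 < n)%N -> 0 <= (n%:R ^- m : R) <= 1.
Proof.
move=> n0; rewrite invr_ge0 exprn_ge0 //= invf_le1 ?exprn_gt0 ?ltr0n //.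
by rewrite exprn_ege1 // ler1n.
Qed.

(** As x tends to 0 the factor n / (n - x) tends to 1 uniformly in n, with error at most 2x. *)
Lemma killed_pow_of_kernel m :
  (forall x, 0 < x -> x <= 2^-1 ->
     killed (fun n => (n%:R ^- m * (n%:R / (n%:R - x)))%:C%C)) ->
  killed (fun n => (n%:R ^- m)%:C%C).
Proof.
move=> IH; apply: killed_lim => e e0; pose y := Num.min (e / 2) 2^-1.
have y0 : 0 < y by rewrite lt_min divr_gt0 //= invr_gt0.
have y2 : y <= 2^-1 by rewrite ge_min lexx orbT.
have ye : y <= e / 2 by rewrite ge_min lexx.
eexists; first exact: (IH y y0 y2).
move=> n n0; have [_ /andP[H1 H2]] := kernel_le n0 y0 y2.
rewrite -rmorphB /= normc_def /= expr0n addr0 sqrtr_sqr lecR distrC.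
have /andP[P0 P1] := invXn_le1 m n0.
rewrite -[X in _ - X]mulr1 -mulrBr normrM !ger0_norm //.
apply: (@le_trans _ _ (1 * (2 * y))); last lra.
exact: ler_pM.
Qed.

(** Induction through n^-(m+1) n / (n - x) = x^-1 (n^-m n / (n - x) - n^-m), where n^-m is killed by
    the limit x -> 0 of the previous stage. *)
Lemma killed_kernel m (x : R) : 0 < x -> x <= 2^-1 ->
  killed (fun n => (n%:R ^- m * (n%:R / (n%:R - x)))%:C%C).
Proof.
elim: m x => [|m IH] x x0 x2.
  split.
    exists 2 => n n0; have [_ /andP[H1 H2]] := kernel_le n0 x0 x2.
    rewrite normc_def /= expr0n addr0 sqrtr_sqr lecR expr0 invr1 mul1r.
    rewrite ger0_norm; lra.
  rewrite -[RHS](L_kernel x0 x2); congr L; apply/funext => n.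
  by rewrite expr0 invr1 mul1r.
have kpow := killed_pow_of_kernel IH.
have := killedD (- x^-1)%:C%C killed0 (killedD (-1) kpow (IH x x0 x2)).
move=> /killed_ext; apply => n n0.
have [d0 _] := kernel_le n0 x0 x2.
rewrite add0r mulN1r -rmorphB /= -rmorphM /=; congr (_ %:C)%C.
have nn0 : n%:R != 0 :> R by rewrite pnatr_eq0 -lt0n.
rewrite exprSr invfM; move: (n%:R : R) nn0 d0 => a nn0 d0.
by field; rewrite nn0 expf_neq0 ?(gt_eqF d0) ?(gt_eqF x0).
Qed.

Lemma killed_pow m : killed (fun n => (n%:R ^- m)%:C%C).
Proof. by apply: killed_pow_of_kernel => x; exact: killed_kernel. Qed.

Lemma killed_delta j : killed (fun n => (n == j)%:R).
Proof.
elim/ltn_ind: j => -[|j] IH; first by apply: killed_ext killed0 _ => -[].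
apply: killed_lim => e e0.
(* The largest ratio (j + 1) / n over n > j + 1: its powers bound the error uniformly beyond the
   target index j + 1. *)
pose t : R := j.+1%:R / j.+2%:R.
have t1 : t < 1 by rewrite ltr_pdivrMr ?ltr0Sn // mul1r ltr_nat.
have t0 : 0 <= t by rewrite divr_ge0.
have [m tm] : exists m, t ^+ m <= e.
  have /cvgrPdist_lt/(_ e e0)[m _ /(_ m (leqnn _))] : (fun m => t ^+ m) @ \oo --> (0 : R).
    by apply: cvg_expr; rewrite ger0_norm.
  by rewrite /= sub0r normrN ger0_norm ?exprn_ge0 // => /ltW; exists m.
(* The values of ((j + 1) / n)^m at smaller n, where it may be large; they are subtracted exactly by
   means of the indicators already killed. *)
pose c (l : nat) : C := ((j.+1%:R / l%:R) ^+ m)%:C%C.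
have kS := killed_sum c IH.
have := killedD (-1) (killedD (j.+1%:R ^+ m)%:C%C killed0 (killed_pow m)) kS.
move=> H; eexists; first exact: H.
move=> n n0 /=; rewrite add0r mulN1r -rmorphM /= -exprVn -exprMn.
have [nj|jn] := ltnP n j.+1.
  rewrite (bigD1 (Ordinal nj)) //= eqxx mulr1 big1 => [|l ln]; last first.
    by rewrite [_ == _]eq_sym (negPf ln : (val l == val (Ordinal nj)) = false) mulr0.
  by rewrite addr0 (ltn_eqF nj) /c subrr subr0 normr0 lecR ltW.
rewrite big1 ?subr0 => [|l _]; last first.
  by rewrite gtn_eqF ?mulr0 // (leq_trans _ jn).
have nR : 0 < n%:R :> R by rewrite ltr0n.
have [->|nj] := eqVneq n j.+1.
  by rewrite divff ?pnatr_eq0 // expr1n subrr normr0 lecR ltW.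
rewrite sub0r normrN normc_def /= expr0n addr0 sqrtr_sqr lecR.
rewrite ger0_norm ?exprn_ge0 ?divr_ge0 //; apply: le_trans tm.
rewrite lerXn2r ?nnegrE ?divr_ge0 // ler_wpM2l // lef_pV2 ?posrE ?ltr0Sn // ler_nat.
by rewrite ltn_neqAle eq_sym nj.
Qed.

Lemma killed_cpow (s : C) : 0 < complex.Re s -> killed (fun n => (cpow n s)^-1).
Proof.
move=> s0; apply: killed_lim => e e0.
(* From [J] on, n is at least [e] to the power -1 / Re s, so |n^-s| <= [e]; below [J] the sequence
   is matched exactly by indicators. *)
pose J := Num.bound (expR (- ln e / complex.Re s)).
have kS := @killed_sum J (fun l => (cpow l s)^-1) _ (fun j _ => killed_delta j).
eexists; first exact: kS.
move=> n n0 /=; have [nJ|Jn] := ltnP n J.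
  rewrite (bigD1 (Ordinal nJ)) //= eqxx mulr1 big1 => [|l ln]; last first.
    by rewrite [_ == _]eq_sym (negPf ln : (val l == val (Ordinal nJ)) = false) mulr0.
  by rewrite addr0 subrr normr0 lecR ltW.
rewrite big1 ?subr0 => [|l _]; last first.
  by rewrite gtn_eqF ?mulr0 // (leq_trans _ Jn).
rewrite normfV normr_cpow -fmorphV lecR /= -expRN -[leRHS]lnK ?posrE // ler_expR.
rewrite -lerNl -ler_pdivrMl // mulrC -ler_expR lnK ?posrE ?ltr0n //.
apply: (@le_trans _ _ J%:R); last by rewrite ler_nat.
by apply/ltW/archi_boundP; exact: expR_ge0.
Qed.

End Functional.

(** * The functional of an index *)

Section IndexFunctional.
Variable R : realType.
Local Notation C := R[i]^o.

Definition index_functional (k : seq nat) (phi : nat -> C) : C :=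
  \sum_(i < size k) csum [set n : (size k).-tuple nat | path ltn 0%N n]
    (fun n => (coef R i n)%:C%C * phi (tnth n i)).

Definition index_bound (k : seq nat) : R :=
  (size k)%:R * ((size k).+1%:R * (2 * (size k).+1)%:R ^+ (size k).-1).

Lemma I_series_functional (k : seq nat) (s : C) :
  I_series k s = index_functional k (fun n => (cpow n s)^-1).
Proof.
apply: eq_bigr => i _; congr csum; apply/funext => n; rewrite /I_term /coef.
rewrite rmorphM /= fmorphV !rmorph_prod /= mulrAC; congr (_^-1 * _ * _).
  by apply: eq_bigr => j _; rewrite rmorphXn /= rmorph_nat.
by apply: eq_bigr => j _; rewrite rmorphM /= fmorphV rmorphB /= !rmorph_nat.
Qed.

Variable k : seq nat.
Hypothesis k_adm : admissible k.
Local Notation D := [set n : (size k).-tuple nat | path ltn 0%N n].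

Lemma size_admissible : (0 < size k)%N.
Proof. by case/andP: k_adm => /andP[]. Qed.

Lemma normr_coef_phi_le (phi : nat -> C) (M : R) (i : 'I_(size k)) (n : (size k).-tuple nat) :
  (forall n, (0 < n)%N -> `|phi n| <= M%:C%C) -> path ltn 0%N n ->
  `|(coef R i n)%:C%C * phi (tnth n i)| <= (M * majorant R (tnth n) i)%:C%C.
Proof.
move=> HM pn; rewrite normrM [leLHS]mulrC (rmorphM _ M) /=; apply: ler_pM => //.
  by apply: HM; exact: path_ltn_tnth_gt0.
by rewrite normc_def /= expr0n addr0 sqrtr_sqr lecR normr_coef_le.
Qed.

Lemma seq_bound_ge0 (phi : nat -> C) (M : R) :
  (forall n, (0 < n)%N -> `|phi n| <= M%:C%C) -> 0 <= M.
Proof. by move=> /(_ 1%N isT)/(le_trans (normr_ge0 _)); rewrite ler0c. Qed.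

Lemma index_functional_has_sum (phi : nat -> C) (i : 'I_(size k)) : seq_bounded phi ->
  exists l, has_sum D (fun n => (coef R i n)%:C%C * phi (tnth n i)) l.
Proof.
move=> [M HM]; apply: (has_sum_summable (g := fun n => M * majorant R (tnth n) i)).
  by move=> n pn; exact: normr_coef_phi_le.
move=> B _; rewrite -mulr_sumr.
by apply: ler_wpM2l (seq_bound_ge0 HM) _ _ (sum_majorant_le _ size_admissible _ _).
Qed.

Lemma index_functional_csum (phi : nat -> C) (i : 'I_(size k)) : seq_bounded phi ->
  has_sum D (fun n => (coef R i n)%:C%C * phi (tnth n i))
    (csum D (fun n => (coef R i n)%:C%C * phi (tnth n i))).
Proof. by move=> /(index_functional_has_sum i)[l Hl]; rewrite (csumE Hl). Qed.

Lemma index_functional_lin (phi psi : nat -> C) (c : C) :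
  seq_bounded phi -> seq_bounded psi ->
  index_functional k (fun n => phi n + c * psi n) =
  index_functional k phi + c * index_functional k psi.
Proof.
move=> bphi bpsi; rewrite /index_functional mulr_sumr -big_split; apply: eq_bigr => i _.
apply: csumE; have := has_sumZ c (index_functional_csum i bpsi).
move=> /(has_sumD (index_functional_csum i bphi)); apply: eq_has_sum => n _.
by rewrite mulrDr [c * (_ * _)]mulrCA.
Qed.

Lemma index_functional_le (phi : nat -> C) (M : R) :
  (forall n, (0 < n)%N -> `|phi n| <= M%:C%C) ->
  `|index_functional k phi| <= (index_bound k * M)%:C%C.
Proof.
move=> HM; have bphi : seq_bounded phi by exists M.
rewrite /index_functional; apply: le_trans (ler_norm_sum _ _ _) _.
rewrite /index_bound -mulrA mulr_natl -[X in _ *+ X]card_ord -sumr_const rmorph_sum /=.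
apply: ler_sum => i _; apply: has_sum_norm_le (index_functional_csum i bphi) _ => B BD.
apply: le_trans (ler_norm_sum _ _ _) _.
apply: le_trans (_ : (\sum_(n <- B) M * majorant R (tnth n) i)%:C%C <= _).
  rewrite rmorph_sum /= big_seq [leRHS]big_seq; apply: ler_sum => n /BD.
  exact: normr_coef_phi_le.
rewrite lecR -mulr_sumr mulrC; apply: ler_wpM2r; first exact: seq_bound_ge0 HM.
exact: sum_majorant_le size_admissible _ _.
Qed.

Lemma seq_bounded_kernel (x : R) : 0 < x -> x <= 2^-1 ->
  seq_bounded (fun n => (n%:R / (n%:R - x))%:C%C : C).
Proof.
move=> x0 x2; exists 2 => n n0; have [_ /andP[H1 H2]] := kernel_le n0 x0 x2.
rewrite normc_def /= expr0n addr0 sqrtr_sqr lecR.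
rewrite ger0_norm; lra.
Qed.

Lemma sum_coef_kernel (x : R) (n : (size k).-tuple nat) : 0 < x -> x < 1 ->
  path ltn 0%N n ->
  \sum_(i < size k) coef R i n * ((tnth n i)%:R / ((tnth n i)%:R - x)) =
  \prod_(j < size k) ((tnth n j)%:R ^+ (nth 0%N k j).-1 * ((tnth n j)%:R - x))^-1.
Proof.
move=> x0 x1 pn.
have n0 j : (0 < tnth n j)%N by exact: path_ltn_tnth_gt0.
rewrite /coef; under eq_bigr do rewrite -mulrA [X in _ * X]mulrC.
rewrite -mulr_sumr (partial_fractions (y := fun j => (tnth n j)%:R)).
- rewrite -prodfV -big_split; apply: eq_bigr => j _ /=.
  have : (0 < nth 0%N k j)%N.
    by case/andP: k_adm => /andP[_ /allP kpos] _; apply: kpos; rewrite mem_nth.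
  case: (nth 0%N k j) => // m _ /=; rewrite exprS !invfM.
  by rewrite mulrACA mulVf ?mul1r // pnatr_eq0 -lt0n.
- exact: size_admissible.
- move=> i j /eqP; rewrite eqr_nat => /eqP ij; apply/eqP; apply: contraT => /(path_ltn_tnth_neq pn).
  by rewrite ij eqxx.
- move=> j; apply: contraTneq x1 => <-; rewrite -leNgt ler1n; exact: n0.
Qed.

(** The value is produced as a real number because the connected sum argument compares real
    series. *)
Lemma index_functional_kernel (x : R) : 0 < x -> x <= 2^-1 ->
  exists2 l : R, index_functional k (fun n => (n%:R / (n%:R - x))%:C%C) = l%:C%C &
   has_sum D (fun n => (\prod_(j < size k)
       (((tnth n j)%:R ^+ (nth 0%N k j).-1 * ((tnth n j)%:R - x))^-1))%:C%C) l%:C%C.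
Proof.
move=> x0 x2; have bk := seq_bounded_kernel x0 x2.
have x1 : x < 1 by lra.
have := has_sum_sum (index_enum _) (fun i => index_functional_csum i bk).
rewrite -/(index_functional k _) => H.
have {}H : has_sum D (fun n => (\prod_(j < size k)
       (((tnth n j)%:R ^+ (nth 0%N k j).-1 * ((tnth n j)%:R - x))^-1))%:C%C)
   (index_functional k (fun n => (n%:R / (n%:R - x))%:C%C)).
  apply: eq_has_sum H => n pn; rewrite -sum_coef_kernel // rmorph_sum /=.
  by apply: eq_bigr => i _; rewrite (rmorphM _ (coef R i n)).
have lE := has_sum_Re H; rewrite lE in H.
by exists (complex.Re (index_functional k (fun n => (n%:R / (n%:R - x))%:C%C))).
Qed.

End IndexFunctional.

Theorem theorem1p3 (R : realType) (k : seq nat) (F G : R[i]^o -> R[i]^o) :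
  admissible k ->
  I_continuation k F ->
  I_continuation (dual_index k) G ->
  meromorphic_eq F G.
Proof.
move=> kadm [mF FE] [mG GE]; have k'adm := admissible_dual_index kadm.
(* Agreement on Re s > 0 suffices, and there n^-s tends to 0, which approximation by finitely many
   indicators requires. *)
apply: meromorphic_eq_near => //; apply: meromorphic_identity => // s s0.
have s1 : -1 < complex.Re s by rewrite (lt_trans _ s0) // ltrN10.
rewrite FE // GE // !I_series_functional; apply/eqP; rewrite -subr_eq0; apply/eqP.
pose L phi := index_functional (R := R) k phi - index_functional (dual_index k) phi.
have [] // := @killed_cpow R L (index_bound R k + index_bound R (dual_index k)) _ _ _ s s0.
- move=> phi psi c bphi bpsi; rewrite /L !index_functional_lin //; ring.
- move=> phi M HM; rewrite mulrDl rmorphD /=; apply: le_trans (ler_normB _ _) _.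
  by apply: lerD; exact: index_functional_le.
- move=> x x0 x2; rewrite /L.
  have [l1 -> H1] := index_functional_kernel kadm x0 x2.
  have [l2 -> H2] := index_functional_kernel k'adm x0 x2.
  by rewrite (index_sum_dual _ _ kadm H1 H2) ?subrr //; lra.
Qed.
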